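(* For every odd integer $n\geq 7$, the complete graph $K_n$ has a diagram $D$ on $S^2$ with $c(D)=Z(n)$ together with a linear maximal tree $T^L$ of $K_n$ such that no edge diagram of $T^L$ has a crossing in $D$ (so $(D;T^L)$ is a based diagram), and such that $D$ has no free hamiltonian cycle.
   Context: $K_n$ is the complete graph on $n$ vertices (simple, every pair of distinct vertices joined by one edge). A diagram $D$ of a graph on the sphere $S^2$ is a drawing of the graph in which vertices are distinct points and edges are arcs (edge diagrams) joining their endpoints, such that all crossings are transverse double points lying in the interiors of edge diagrams. $c(D)$ denotes the number of crossings of $D$. Set $Z(n)=\frac14\lfloor \frac n2\rfloor\lfloor\frac{n-1}2\rfloor\lfloor\frac{n-2}2\rfloor\lfloor\frac{n-3}2\rfloor$; a diagram $D$ of $K_n$ is called optimal if $c(D)=Z(n)$. A linear maximal tree $T^L$ of $K_n$ is a spanning tree with no vertex of degree $\geq 3$ (i.e. a hamiltonian path). A based diagram $(D;T)$ is a diagram $D$ in which the edge diagrams of the tree $T$ have no crossings. A free hamiltonian cycle of $D$ is a hamiltonian cycle of $K_n$ (a cycle through all vertices) none of whose edge diagrams has a crossing in $D$. *)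

(* Defs.v *)
From HB Require Import structures.
From mathcomp Require Import all_boot all_order all_algebra.
From mathcomp Require Import all_classical all_reals all_analysis.
Set Implicit Arguments. Unset Strict Implicit. Unset Printing Implicit Defensive.
Import Order.TTheory GRing.Theory Num.Theory.
Import numFieldNormedType.Exports.
Local Open Scope classical_set_scope.
Local Open Scope ring_scope.

(* Z(n) = 1/4 floor(n/2) floor((n-1)/2) floor((n-2)/2) floor((n-3)/2)
   (the product is always divisible by 4, so %/ is exact). *)
Definition Zn (n : nat) : nat :=
  ((half n * half (n - 1) * half (n - 2) * half (n - 3)) %/ 4)%N.

Definition edge (n : nat) := {p : 'I_n * 'I_n | (p.1 < p.2)%N}.

Section Diagrams.
Variable R : realType.

Definition point := 'rV[R]_3.

Definition on_sphere (p : point) : Prop := \sum_(i < 3) p ord0 i ^+ 2 = 1.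

(* A drawing of K_n: vertex positions and a parametrized arc [0,1] -> S^2
   for each edge, going from its smaller to its larger endpoint. *)
Record drawing (n : nat) := Drawing {
  vpos : 'I_n -> point ;
  arc  : edge n -> R -> point }.

Definition in01 (t : R) := 0 <= t <= 1.
Definition inside01 (t : R) := 0 < t < 1.

Definition meet_at n (D : drawing n) (e1 e2 : edge n) (s t : R) : Prop :=
  e1 != e2 /\ inside01 s /\ inside01 t /\ arc D e1 s = arc D e2 t.

Definition is_crossing n (D : drawing n) (p : point) : Prop :=
  exists e1 e2 s t, meet_at D e1 e2 s t /\ arc D e1 s = p.

(* D is a diagram of K_n on S^2: vertices are distinct points of S^2,
   edges are simple arcs in S^2 joining their endpoints, whose interiors
   avoid the vertices, and all crossings are transverse double points
   in the interiors of edge diagrams (transversality is taken in the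
   differentiable sense: both arcs are differentiable at the crossing
   with linearly independent tangent vectors). There are finitely many
   crossings. *)
Definition is_diagram n (D : drawing n) : Prop :=
  [/\ injective (vpos D),
      (forall v, on_sphere (vpos D v)),
      (forall e, [/\ forall t, in01 t -> on_sphere (arc D e t),
                  {within `[0, 1], continuous (arc D e)},
                  (forall s t, in01 s -> in01 t -> arc D e s = arc D e t -> s = t),
                  arc D e 0 = vpos D (sval e).1 /\ arc D e 1 = vpos D (sval e).2 &
                  forall t v, inside01 t -> arc D e t != vpos D v]),
      (forall e1 e2 s t, meet_at D e1 e2 s t ->
         [/\ derivable (arc D e1) s 1, derivable (arc D e2) t 1,
             row_free (col_mx ('D_1 (arc D e1) s) ('D_1 (arc D e2) t)) &
             forall e3 u, e3 != e1 -> e3 != e2 -> inside01 u ->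
               arc D e3 u != arc D e1 s]) &
      (exists s : seq point, forall p, p \in s <-> is_crossing D p)].

Definition crossing_number_is n (D : drawing n) (k : nat) : Prop :=
  exists s : seq point, [/\ uniq s, size s = k &
                           forall p, p \in s <-> is_crossing D p].

Definition edge_crossed n (D : drawing n) (e : edge n) : Prop :=
  exists e' s t, meet_at D e e' s t.

End Diagrams.

Definition consec n (s : seq 'I_n) (i j : 'I_n) : Prop :=
  exists k, [/\ (k.+1 < size s)%N, nth i s k = i & nth i s k.+1 = j].

Definition ham_path n (s : seq 'I_n) : Prop := uniq s /\ size s = n.

Definition edge_in_path n (s : seq 'I_n) (e : edge n) : Prop :=
  consec s (sval e).1 (sval e).2 \/ consec s (sval e).2 (sval e).1.

Definition ham_cycle n (s : seq 'I_n) : Prop := (2 < n)%N /\ uniq s /\ size s = n.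

Definition edge_in_cycle n (s : seq 'I_n) (e : edge n) : Prop :=
  match s with
  | [::] => False
  | x :: _ => edge_in_path (rcons s x) e
  end.

Definition based R n (D : drawing R n) (T : seq 'I_n) : Prop :=
  forall e, edge_in_path T e -> ~ edge_crossed D e.

Definition free_ham_cycle R n (D : drawing R n) (C : seq 'I_n) : Prop :=
  ham_cycle C /\ forall e, edge_in_cycle C e -> ~ edge_crossed D e.

(* Main.v *)
(** The vertices [0 .. 2 m] of [K_(2m+1)] lie on the equator, and the edge joining [i] and
    [j] is the chord [i j] lifted to the upper hemisphere when [(i + j) mod (2 m + 1) <= m]
    and to the lower one otherwise.  This drawing has [Z (2 m + 1)] crossings, and its
    equatorial cycle is free.  The edge [2 -- 2 m - 1] is then rerouted so that it leaves [2]
    in the upper hemisphere, crosses the equator between the vertices [2 m] and [0], and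
    reaches [2 m - 1] in the lower hemisphere.  It had [3 m - 6] crossings and it still has
    [3 m - 6], but one of them is now with the edge [0 -- 2 m], so that the free
    hamiltonian cycle shrinks to a free hamiltonian path.  For [m > 3] every edge at [0]
    except [0 -- 1] is crossed, hence no free hamiltonian cycle remains; for [m = 3] a few
    more edges are free and the possible cycles are enumerated.

    Generic positions of the vertices on the circle, which exclude triple points, come from
    rational parameters growing so fast that the concurrency determinant of three chords is
    dominated by one of its terms. *)

Require Import Defs.
From HB Require Import structures.
From mathcomp Require Import all_boot all_order all_algebra.
From mathcomp Require Import all_classical all_reals all_analysis.
From mathcomp Require Import zify ring lra.
Set Implicit Arguments. Unset Strict Implicit. Unset Printing Implicit Defensive.

(** * Counting the crossings *)

Lemma modn_lt_double a N : a < N.*2 -> a %% N = if a < N then a else a - N.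
Proof.
move=> ha; case: ltnP => h; first by rewrite modn_small.
by rewrite -{1}(subnK h) modnDr modn_small //; lia.
Qed.

(** Here [s] is the sum of the end points of a chord. In a regular [(2 m + 1)]-gon two chords are
    parallel exactly when these sums agree modulo [2 m + 1], so each page consists of consecutive
    classes of parallel chords. *)
Definition page (m s : nat) : bool := s %% m.*2.+1 <= m.

Lemma sum_nat_of_bool_itv n lo hi : hi <= n ->
  \sum_(0 <= i < n) ((lo <= i < hi) : nat) = hi - lo.
Proof.
move=> hn.
have [lohi|hilo] := leqP lo hi; last first.
  by rewrite big1_seq => [|i _]; first (by lia); case: andP => //; lia.
rewrite (big_cat_nat (n := lo)) //=; last by lia.
rewrite big_nat_cond big1 => [|i]; last by case: (boolP (lo <= i)) => //; lia.
rewrite add0n (big_cat_nat (n := hi)) //= [X in _ + X]big_nat_cond.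
rewrite [X in _ + X]big1 => [|i]; last by case: (boolP (i < hi)); rewrite ?andbF //; lia.
rewrite addn0 big_nat_cond (eq_bigr (fun=> 1)) => [|i]; last by case: (lo <= i < hi).
by rewrite -big_nat_cond sum_nat_const_nat muln1.
Qed.

Lemma sum_modn_shift n (k : nat) (F : nat -> nat) : 0 < n ->
  \sum_(0 <= i < n) F ((k + i) %% n) = \sum_(0 <= i < n) F i.
Proof.
move=> n0; rewrite !big_mkord.
pose f (i : 'I_n) : 'I_n := Ordinal (ltn_pmod (k + i) n0).
rewrite [RHS](reindex_inj (h := f)) //.
move=> i j /(congr1 val) /= /eqP; rewrite eqn_modDl !modn_small // => /eqP.
exact: val_inj.
Qed.

(** Since [2 m + 1] is odd, doubling permutes the residues. *)
Lemma sum_modn_double m (k : nat) (F : nat -> nat) :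
  \sum_(0 <= i < m.*2.+1) F ((i.*2 + k) %% m.*2.+1) = \sum_(0 <= i < m.*2.+1) F i.
Proof.
rewrite -[RHS](sum_modn_shift k) // !big_mkord.
pose f (i : 'I_m.*2.+1) : 'I_m.*2.+1 := Ordinal (ltn_pmod i.*2 (ltn0Sn m.*2)).
have fi : injective f.
  move=> i j /(congr1 val) /=; have := ltn_ord i; have := ltn_ord j.
  by move=> hj hi; rewrite !modn_lt_double; try lia; do 2![case: ifP => ?] => ?;
     apply: val_inj => /=; lia.
rewrite [RHS](reindex_inj (h := f)) //=; apply: eq_bigr => i _.
by rewrite modnDmr addnC.
Qed.

(** Invariant under rotation, unlike [a < c < b < d]. The arguments follow the circle, so the two
    crossing chords are [a b] and [c d]. *)
Definition cyclic4 (a c b d : nat) : bool :=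
  [|| [&& a < c, c < b & b < d], [&& c < b, b < d & d < a],
      [&& b < d, d < a & a < c] | [&& d < a, a < c & c < b]].

(** In the successive gaps [x], [y], [z] the condition no longer depends on [a], so that the sum
    over [a] can be isolated. *)
Lemma cyclic4_shift n a x y z : a < n -> x < n -> y < n -> z < n ->
  cyclic4 a ((a + x) %% n) ((a + x + y) %% n) ((a + x + y + z) %% n) =
  [&& 0 < x, 0 < y, 0 < z & x + y + z < n].
Proof.
move=> ha hx hy hz.
rewrite -(modnDml (a + x + y)) -(modnDml (a + x)).
have n0 : 0 < n by lia.
(* Each sum is below [2 n], so a reduction subtracts [n] at most once; the residue then becomes a
   variable and the problem is linear. *)
have := ltn_pmod (a + x) n0; have : (a + x) %% n = a + x \/ (a + x) %% n + n = a + x.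
  by rewrite modn_lt_double; [case: ltnP|]; lia.
move: ((a + x) %% n) => c ec hc.
have := ltn_pmod (c + y) n0; have : (c + y) %% n = c + y \/ (c + y) %% n + n = c + y.
  by rewrite modn_lt_double; [case: ltnP|]; lia.
move: ((c + y) %% n) => b eb hb.
have := ltn_pmod (b + z) n0; have : (b + z) %% n = b + z \/ (b + z) %% n + n = b + z.
  by rewrite modn_lt_double; [case: ltnP|]; lia.
move: ((b + z) %% n) => d ed hd; rewrite /cyclic4.
case: (ltnP a c) => h1; case: (ltnP c b) => h2; case: (ltnP b d) => h3;
  case: (ltnP d a) => h4 /=;
  (try (symmetry; apply/and4P; split; lia)); apply/esym/negbTE/negP => /and4P[]; lia.
Qed.

Lemma page_mod m s : page m (s %% m.*2.+1) = page m s.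
Proof. by rewrite /page modn_mod. Qed.

Lemma page_small m s : s < m.*2.+1 -> page m s = (s <= m).
Proof. by move=> h; rewrite /page modn_small. Qed.

Definition same_page_shift m (d : nat) : nat :=
  \sum_(0 <= s < m.*2.+1) (page m s == page m (s + d)).

(** The pages are two complementary intervals of residues, of lengths [m + 1] and [m]. A shift by
    [d <= m] changes the page of the last [d] residues of each. The two intervals below collect the
    residues that stay on the upper and on the lower page. *)
Lemma same_page_shift_small m d : d <= m -> same_page_shift m d = m.*2.+1 - d.*2.
Proof.
move=> hd; rewrite /same_page_shift.
transitivity (\sum_(0 <= s < m.*2.+1)
  (((0 <= s < m.+1 - d) : nat) + ((m.+1 <= s < m.*2.+1 - d) : nat))).
  rewrite !big_mkord; apply: eq_bigr => -[s hs] _ /=.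
  rewrite page_small // /page modn_lt_double; last by lia.
  case: (ltnP (s + d) m.*2.+1) => h; (do 2!case: leqP => ? /=); lia.
by rewrite big_split !sum_nat_of_bool_itv /=; lia.
Qed.

(** A shift by [d] is a backward shift by [2 m + 1 - d <= m], whence the mirrored formula. *)
Lemma same_page_shift_large m d : m < d < m.*2.+1 ->
  same_page_shift m d = d.*2 - m.*2.+1.
Proof.
move=> hd; rewrite /same_page_shift.
transitivity (\sum_(0 <= s < m.*2.+1)
  (((m.*2.+1 - d <= s < m.+1) : nat) + ((m + m.*2.+2 - d <= s < m.*2.+1) : nat))).
  rewrite !big_mkord; apply: eq_bigr => -[s hs] _ /=.
  rewrite page_small // /page modn_lt_double; last by lia.
  by case: (ltnP (s + d) m.*2.+1) => h; do 2!case: leqP => ? /=; lia.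
by rewrite big_split !sum_nat_of_bool_itv /=; lia.
Qed.

Definition two_page_crossings m : nat :=
  \sum_(0 <= a < m.*2.+1) \sum_(0 <= c < m.*2.+1) \sum_(0 <= b < m.*2.+1)
  \sum_(0 <= d < m.*2.+1) [&& a < c, c < b, b < d & page m (a + b) == page m (c + d)].

Lemma eq_bigr_nat n (F G : nat -> nat) : (forall i, i < n -> F i = G i) ->
  \sum_(0 <= i < n) F i = \sum_(0 <= i < n) G i.
Proof. by move=> h; rewrite !big_mkord; apply: eq_bigr => -[i hi] _; apply: h. Qed.

Definition sum4 n (G : nat -> nat -> nat -> nat -> nat) : nat :=
  \sum_(0 <= a < n) \sum_(0 <= c < n) \sum_(0 <= b < n) \sum_(0 <= d < n) G a c b d.

Lemma sum4D n (F G : nat -> nat -> nat -> nat -> nat) :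
  sum4 n (fun a c b d => F a c b d + G a c b d) = sum4 n F + sum4 n G.
Proof.
rewrite /sum4 -big_split; apply: eq_bigr => a _.
rewrite -big_split; apply: eq_bigr => c _.
by rewrite -big_split; apply: eq_bigr => b _; rewrite -big_split.
Qed.

Lemma eq_sum4 n (F G : nat -> nat -> nat -> nat -> nat) :
  (forall a c b d, F a c b d = G a c b d) -> sum4 n F = sum4 n G.
Proof. by move=> h; rewrite /sum4; do 4!(apply: eq_bigr => ? _); apply: h. Qed.

Lemma sum4_rot n (G : nat -> nat -> nat -> nat -> nat) :
  sum4 n (fun a c b d => G c b d a) = sum4 n G.
Proof.
rewrite /sum4 exchange_big; apply: eq_bigr => c _; rewrite exchange_big.
by apply: eq_bigr => b _; rewrite exchange_big.
Qed.

(* Each crossing of chords has four cyclically ordered labellings of its end points. *)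
Lemma two_page_crossings_cyclic m :
  \sum_(0 <= a < m.*2.+1) \sum_(0 <= c < m.*2.+1) \sum_(0 <= b < m.*2.+1)
  \sum_(0 <= d < m.*2.+1) (cyclic4 a c b d && (page m (a + b) == page m (c + d)))
  = 4 * two_page_crossings m.
Proof.
set n := m.*2.+1.
pose F a c b d : nat := [&& a < c, c < b, b < d & page m (a + b) == page m (c + d)].
have FE a c b d : (cyclic4 a c b d && (page m (a + b) == page m (c + d)) : nat) =
    F a c b d + F c b d a + (F b d a c + F d a c b).
  rewrite /F /cyclic4 (addnC b a) (addnC d c) (eq_sym (page m (c + d))).
  by case: eqP => _; rewrite ?andbF ?andbT //; lia.
have -> : two_page_crossings m = sum4 n F by [].
transitivity (sum4 n (fun a c b d => F a c b d + F c b d a + (F b d a c + F d a c b))).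
  exact: eq_sum4.
rewrite !sum4D (sum4_rot n F) (sum4_rot n (fun a c b d => F b d a c)).
by rewrite (sum4_rot n (fun a c b d => F c b d a)) (sum4_rot n F); lia.
Qed.

(** With [c = a + x], [b = c + y], [d = b + z] one has [a + b = 2 a + x + y] and
    [c + d = (a + b) + (x + z)] modulo [2 m + 1]. As [a] varies, [2 a + x + y] takes every residue
    once, so the inner sum is [same_page_shift m (x + z)]. *)
Lemma two_page_crossings_gaps m :
  4 * two_page_crossings m =
  \sum_(0 <= x < m.*2.+1) \sum_(0 <= y < m.*2.+1) \sum_(0 <= z < m.*2.+1)
    [&& 0 < x, 0 < y, 0 < z & x + y + z < m.*2.+1] * same_page_shift m (x + z).
Proof.
rewrite -two_page_crossings_cyclic; set n := m.*2.+1.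
transitivity (\sum_(0 <= a < n) \sum_(0 <= x < n) \sum_(0 <= y < n) \sum_(0 <= z < n)
  [&& 0 < x, 0 < y, 0 < z & x + y + z < n] *
  (page m ((a.*2 + (x + y)) %% n) == page m ((a.*2 + (x + y)) %% n + (x + z)))).
  apply: eq_bigr_nat => a ha; rewrite -(sum_modn_shift a) //.
  apply: eq_bigr_nat => x hx; rewrite -(sum_modn_shift (a + x)) //.
  apply: eq_bigr_nat => y hy; rewrite -(sum_modn_shift (a + x + y)) //.
  apply: eq_bigr_nat => z hz; rewrite cyclic4_shift //.
  have -> : page m (a + (a + x + y) %% n) = page m ((a.*2 + (x + y)) %% n).
    by rewrite page_mod -page_mod modnDmr page_mod; congr page; lia.
  have -> : page m ((a + x) %% n + (a + x + y + z) %% n) =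
            page m ((a.*2 + (x + y)) %% n + (x + z)).
    by rewrite -page_mod modnDm -[RHS]page_mod modnDml !page_mod; congr page; lia.
  by rewrite -mulnb.
rewrite exchange_big; apply: eq_bigr => x _.
rewrite exchange_big; apply: eq_bigr => y _.
rewrite exchange_big; apply: eq_bigr => z _.
rewrite -big_distrr /=; congr (_ * _).
exact: (sum_modn_double m (x + y) (fun s => page m s == page m (s + (x + z)))).
Qed.

Lemma sum_add_eq n d : d < n ->
  \sum_(0 <= x < n) \sum_(0 <= z < n) [&& 0 < x, 0 < z & x + z == d] = d.-1.
Proof.
move=> hd; transitivity (\sum_(0 <= x < n) (1 <= x < d)).
  apply: eq_bigr_nat => x hx.
  transitivity (\sum_(0 <= z < n) ((d - x <= z < (if 1 <= x < d then (d - x).+1 else 0)) : nat)).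
    by apply: eq_bigr_nat => z hz; case: ifP; lia.
  by rewrite sum_nat_of_bool_itv; case: ifP; lia.
by rewrite sum_nat_of_bool_itv; lia.
Qed.

(** A shift [d = x + z] comes from [d - 1] pairs of positive gaps and leaves [2 m - d] values for
    [y]. *)
Lemma two_page_crossings_shifts m :
  4 * two_page_crossings m =
  \sum_(0 <= d < m.*2.+1) d.-1 * (m.*2 - d) * same_page_shift m d.
Proof.
rewrite two_page_crossings_gaps; set n := m.*2.+1.
transitivity (\sum_(0 <= x < n) \sum_(0 <= z < n) \sum_(0 <= d < n)
    [&& 0 < x, 0 < z & x + z == d] * ((m.*2 - d) * same_page_shift m d)).
  apply: eq_bigr_nat => x hx; rewrite exchange_big /=; apply: eq_bigr_nat => z hz.
  have [xz|xz] := ltnP (x + z) n; last first.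
    rewrite !big_mkord !big1 // => -[i hi] _ /=.
      have -> : (x + z == i) = false by lia.
      by rewrite !andbF.
    have -> : (x + i + z < n) = false by lia.
    by rewrite !andbF.
  rewrite [RHS]big_mkord [RHS](bigD1 (Ordinal xz)) //= eqxx andbT.
  rewrite [X in _ = _ + X]big1 ?addn0; last first.
    move=> -[i hi] /= /eqP ne.
    case: eqP => e; last by rewrite !andbF.
    by case: ne; apply: val_inj.
  rewrite -big_distrl /= mulnA; congr (_ * _).
  transitivity (\sum_(0 <= y < n) ((1 <= y < (if (0 < x) && (0 < z) then n - (x + z) else 0)) : nat)).
    by apply: eq_bigr_nat => y hy; case: ifP; lia.
  by rewrite sum_nat_of_bool_itv; case: ifP; lia.
transitivity (\sum_(0 <= d < n) \sum_(0 <= x < n) \sum_(0 <= z < n)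
    [&& 0 < x, 0 < z & x + z == d] * ((m.*2 - d) * same_page_shift m d)).
  rewrite [RHS]exchange_big; apply: eq_bigr => x _; exact: exchange_big.
apply: eq_bigr_nat => d hd; rewrite -mulnA -{1}(sum_add_eq hd) big_distrl.
by apply: eq_bigr => x _; rewrite big_distrl.
Qed.

(* With [p d = (d - 1) (2 m - d)] one has [p (d + 1) - p (d - 1) = 2 (2 m + 1 - 2 d)],
   so the summand telescopes to [p d * p (d + 1) / 2]. *)
Lemma sum_shifts_low m k : k <= m ->
  (\sum_(0 <= d < k.+1) d.-1 * (m.*2 - d) * (m.*2.+1 - d.*2)) * 2 =
  k.-1 * (m.*2 - k) * (k * (m.*2 - k.+1)).
Proof.
elim: k => [|k IH] hk; first by rewrite big_nat1.
rewrite big_nat_recr //= mulnDl IH; last by lia.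
case: k hk {IH} => [|k] hk; first by rewrite !mul0n.
have [r ->] : exists r, m = k.+2 + r by exists (m - k.+2); lia.
have -> : (k.+2 + r).*2 - k.+1 = k + r.*2 + 3 by lia.
have -> : (k.+2 + r).*2 - k.+2 = k + r.*2 + 2 by lia.
have -> : (k.+2 + r).*2 - k.+3 = k + r.*2 + 1 by lia.
have -> : (k.+2 + r).*2.+1 - k.+2.*2 = r.*2 + 1 by lia.
rewrite -!mul2n /=; ring.
Qed.

(** Beyond [m] the same telescoping has the opposite sign and descends from [p m * p (m + 1)], where
    [p m = p (m + 1) = m (m - 1)]. *)
Lemma sum_shifts_high m k : m < k <= m.*2 ->
  (\sum_(m.+1 <= d < k.+1) d.-1 * (m.*2 - d) * (d.*2 - m.*2.+1)) * 2 +
  k.-1 * (m.*2 - k) * (k * (m.*2 - k.+1)) = (m * m.-1) ^ 2.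
Proof.
elim: k => [//|k IH] hk.
rewrite big_nat_recr /=; last by lia.
have [km|km] := eqVneq k m.
  rewrite km big_geq //; case: (m) => [|p]; first by rewrite !muln0.
  have -> : p.+1.*2 - p.+2 = p by lia.
  case: p => [|p] //.
  have -> : p.+2.*2 - p.+4 = p by lia.
  have -> : p.+3.*2 - p.+2.*2.+1 = 1 by lia.
  by rewrite /=; ring.
rewrite -IH; last by lia.
rewrite mulnDl -!addnA; congr (_ + _).
case: k hk km {IH} => [|k] hk km; first by lia.
(* At the end of the range the factor [2 m - (k + 2)] kills every term; elsewhere all the truncated
   subtractions are exact. *)
have [hr|hr] := eqVneq k.+2 m.*2; first by rewrite -hr !subnn !muln0; nia.
have [r hr'] : exists r, m.*2 = k + 3 + r by exists (m.*2 - k - 3); lia.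
have -> : m.*2 - k.+1 = r + 2 by lia.
have -> : m.*2 - k.+2 = r + 1 by lia.
have -> : m.*2 - k.+3 = r by lia.
have : k.+2.*2 - m.*2.+1 + r = k by lia.
move: (k.+2.*2 - m.*2.+1) => t <- /=; ring.
Qed.

(** Shifts up to [m] and shifts beyond [m] contribute equally, each half of the total. *)
Lemma two_page_crossings_eq m : 4 * two_page_crossings m = (m * m.-1) ^ 2.
Proof.
case: m => [|m]; first by rewrite two_page_crossings_shifts big_nat1.
rewrite two_page_crossings_shifts (big_cat_nat (n := m.+2)) //=; last by lia.
set S1 := (X in X + _); set S2 := (X in _ + X).
have E1 : S1 * 2 = (m.+1 * m) ^ 2.
  have := @sum_shifts_low m.+1 m.+1 (leqnn _).
  have -> : m.+1.*2 - m.+1 = m.+1 by lia.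
  have -> : m.+1.*2 - m.+2 = m by lia.
  move=> /= h; have <- : m * m.+1 * (m.+1 * m) = (m.+1 * m) ^ 2 by ring.
  rewrite -h; congr (_ * _); apply: eq_bigr_nat => d hd.
  by rewrite same_page_shift_small.
have E2 : S2 * 2 = (m.+1 * m) ^ 2.
  have := @sum_shifts_high m.+1 m.+1.*2; rewrite subnn muln0 addn0 => <-; last by lia.
  congr (_ * _); rewrite /S2 big_nat_cond [RHS]big_nat_cond.
  by apply: eq_bigr => d; rewrite andbT => hd; rewrite same_page_shift_large //; lia.
by rewrite /=; lia.
Qed.

(** * Crossings after rerouting one edge *)

Definition rerouted m (a b : nat) : bool := (a == 2) && (b == m.*2.-1).

(* Points [0 .. 2 m] are the vertices; [2 m + 1] is the point of the equator, between
   the vertices [2 m] and [0], where the rerouted edge [2 -- 2 m - 1] changes page. *)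
Definition piece m (p : bool) (a b : nat) : bool :=
  [&& a < b, b <= m.*2.+1 &
   if b == m.*2.+1 then a == (if p then 2 else m.*2.-1)
   else ~~ rerouted m a b && (page m (a + b) == p)].

Definition interleaved (a b c d : nat) : bool := [&& a < c, c < b & b < d].

(** The arguments are in their order on the circle, whereas [interleaved] takes them chord by
    chord. *)
Definition piece_crossing m (a c b d : nat) : bool :=
  interleaved a b c d && [exists p, piece m p a b && piece m p c d].

Lemma sum4_box n a0 a1 c0 c1 b0 b1 d0 d1 :
  a1 <= n -> c1 <= n -> b1 <= n -> d1 <= n ->
  sum4 n (fun a c b d => [&& a0 <= a < a1, c0 <= c < c1, b0 <= b < b1 & d0 <= d < d1]) =
  (a1 - a0) * ((c1 - c0) * ((b1 - b0) * (d1 - d0))).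
Proof.
move=> ha hc hb hd; rewrite /sum4 -(sum_nat_of_bool_itv a0 ha) big_distrl.
apply: eq_bigr => a _; rewrite -(sum_nat_of_bool_itv c0 hc) big_distrl big_distrr.
apply: eq_bigr => c _; rewrite -(sum_nat_of_bool_itv b0 hb) big_distrl !big_distrr.
apply: eq_bigr => b _; rewrite -(sum_nat_of_bool_itv d0 hd) !big_distrr.
by apply: eq_bigr => d _ /=; rewrite !mulnb.
Qed.

Lemma eq_sum4_in n (F G : nat -> nat -> nat -> nat -> nat) :
  (forall a c b d, a < n -> c < n -> b < n -> d < n -> F a c b d = G a c b d) ->
  sum4 n F = sum4 n G.
Proof.
move=> h; rewrite /sum4; apply: eq_bigr_nat => a ha; apply: eq_bigr_nat => c hc.
by apply: eq_bigr_nat => b hb; apply: eq_bigr_nat => d hd; apply: h.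
Qed.

Lemma pageE m s : s < m.*2.+1.*2 -> page m s = (s <= m) || (m.*2.+1 <= s <= m.*2.+1 + m).
Proof. by move=> h; rewrite /page modn_lt_double //; case: ltnP => ?; lia. Qed.

Lemma piece_crossingE m a c b d : piece_crossing m a c b d =
  interleaved a b c d && (piece m true a b && piece m true c d ||
                          piece m false a b && piece m false c d).
Proof.
congr (_ && _); apply/existsP/orP => [[[] h]|[h|h]]; first by left.
- by right.
- by exists true.
- by exists false.
Qed.

(** Adds the index [2 m + 1] of the extra equatorial point, for a term by term comparison with the
    pieces. *)
Lemma two_page_crossings_widen m : two_page_crossings m =
  sum4 m.*2.+2 (fun a c b d => [&& d <= m.*2, a < c, c < b, b < d &
                                page m (a + b) == page m (c + d)]).
Proof.
rewrite /two_page_crossings /sum4.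
rewrite [RHS]big_nat_recr // [X in _ = _ + X]big1_seq ?addn0 => [|c]; last first.
  rewrite andTb mem_index_iota => hc.
  by do 2![rewrite big1 => [//|? _]]; lia.
apply: eq_bigr_nat => a ha.
rewrite [RHS]big_nat_recr // [X in _ = _ + X]big1_seq ?addn0 => [|b]; last first.
  rewrite andTb mem_index_iota => hc.
  by rewrite big1 => [//|? _]; lia.
apply: eq_bigr_nat => c hc.
rewrite [RHS]big_nat_recr // [X in _ = _ + X]big1_seq ?addn0 => [|d]; last first.
  by rewrite andTb mem_index_iota => hd; lia.
apply: eq_bigr_nat => b hb.
rewrite [RHS]big_nat_recr //= ltnn addn0.
by apply: eq_bigr_nat => d hd; have -> : d <= m.*2 by lia.
Qed.

Local Ltac false_summands :=
  repeat match goal with |- context [nat_of_bool ?b] =>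
    lazymatch b with false => fail | true => fail | _ =>
    have -> : b = false by (apply/negbTE/negP => /=; lia) end end.

(* On the left, the crossings of the edge [2 -- 2 m - 1] before it is rerouted; on the
   right, those of its two pieces. *)
Lemma piece_crossing_pointwise m a c b d : 2 < m ->
  a < m.*2.+2 -> c < m.*2.+2 -> b < m.*2.+2 -> d < m.*2.+2 ->
  piece_crossing m a c b d +
  ([&& 2 <= a < 3, 3 <= c < m.+2, m.*2.-1 <= b < m.*2 & m.*2 <= d < m.*2.+1] +
   [&& 0 <= a < 1, 2 <= c < 3, 3 <= b < m.+1 & m.*2.-1 <= d < m.*2] +
   [&& 1 <= a < 2, 2 <= c < 3, 3 <= b < m & m.*2.-1 <= d < m.*2]) =
  [&& d <= m.*2, a < c, c < b, b < d & page m (a + b) == page m (c + d)] +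
  ([&& 0 <= a < 1, 2 <= c < 3, 3 <= b < m.+1 & m.*2.+1 <= d < m.*2.+2] +
   [&& 1 <= a < 2, 2 <= c < 3, 3 <= b < m & m.*2.+1 <= d < m.*2.+2] +
   [&& 1 <= a < 2, 2 <= c < 3, m.*2 <= b < m.*2.+1 & m.*2.+1 <= d < m.*2.+2] +
   [&& m.+2 <= a < m.*2.-1, m.*2.-1 <= c < m.*2, m.*2 <= b < m.*2.+1 &
       m.*2.+1 <= d < m.*2.+2] +
   [&& 0 <= a < 1, m.*2.-1 <= c < m.*2, m.*2 <= b < m.*2.+1 &
       m.*2.+1 <= d < m.*2.+2]).
Proof.
move=> hm ha hc hb hd.
have [acbd|nacbd] := boolP [&& a < c, c < b & b < d]; last first.
  rewrite piece_crossingE /interleaved (negbTE nacbd).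
  have {}nacbd : a < c -> c < b -> b < d -> False.
    by move=> h1 h2 h3; rewrite h1 h2 h3 in nacbd.
  by false_summands.
rewrite piece_crossingE /interleaved acbd /=.
case/and3P: acbd => h1 h2 h3.
rewrite /piece h1 (ltn_trans h1 h2) (ltn_trans h2 h3) /= h2 h3.
have -> : b == m.*2.+1 = false by lia.
have -> : b <= m.*2.+1 by lia.
have -> : d <= m.*2.+1 by lia.
have -> : page m (a + b) = (a + b <= m) || (m.*2.+1 <= a + b <= m.*2.+1 + m).
  by apply: pageE; lia.
have -> : page m (c + d) = (c + d <= m) || (m.*2.+1 <= c + d <= m.*2.+1 + m).
  by apply: pageE; lia.
rewrite /=.
(* A chord ending at [2 m + 1] is a half of the rerouted edge: the upper one when [c = 2], the lower
   one when [c = 2 m - 1]. *)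
have [dn|dn] := eqVneq d m.*2.+1.
  subst d; rewrite ltnn /= /rerouted.
  have [c2|c2] := eqVneq c 2.
    subst c; have /orP[/eqP a0|/eqP a1] : (a == 0) || (a == 1) by lia.
      by subst a; case: leqP => ? /=; false_summands; lia.
    by subst a; case: leqP => ? /=; false_summands; lia.
  have [cw|cw] := eqVneq c m.*2.-1; last by rewrite !andbF; false_summands.
  have -> : b = m.*2 by lia.
  subst c; have [a0|a0] := eqVneq a 0; first by subst a; false_summands; lia.
  by case: (leqP (a + m.*2) m) => ?; case: (leqP _ (m.*2.+1 + m)) => ? /=;
    false_summands; lia.
have -> : d <= m.*2 by lia.
(* Crossings lost by the rerouting: the old chord [2 -- 2 m - 1] is first [a b], then [c d]. *)
have [/andP[/eqP a2 /eqP bw]|rab] := boolP (rerouted m a b).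
  subst a b; rewrite /=; have -> : d = m.*2 by lia.
  by case: (leqP (c + m.*2) m) => ?; case: (leqP _ (m.*2.+1 + m)) => ? /=;
    false_summands; lia.
have [/andP[/eqP c2 /eqP dw]|rcd] := boolP (rerouted m c d); rewrite ?andbF /=.
  subst c d; have /orP[/eqP a0|/eqP a1] : (a == 0) || (a == 1) by lia.
    by subst a; case: (leqP (0 + b) m) => ? /=; false_summands; lia.
  by subst a; case: (leqP (1 + b) m) => ?; case: (leqP _ (m.*2.+1 + m)) => ? /=;
    false_summands; lia.
rewrite /rerouted in rab rcd.
set P := (X in X == true); set P' := (X in _ && (X == true)).
have -> : (P == true) && (P' == true) || (P == false) && (P' == false) = (P == P').
  by case: P P' => -[].
by case: (P == P'); false_summands; lia.
Qed.

(** The boxes on both sides have total size [3 m - 6]: [(m - 1) + (m - 2) + (m - 3)] crossings are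
    lost and [(m - 2) + (m - 3) + 1 + (m - 3) + 1] are gained. *)
Lemma piece_crossing_count m : 2 < m ->
  sum4 m.*2.+2 (piece_crossing m) = two_page_crossings m.
Proof.
move=> hm.
have /eqP := eq_sum4_in (fun a c b d => @piece_crossing_pointwise m a c b d hm).
rewrite !sum4D -two_page_crossings_widen !sum4_box; try lia.
Qed.

Import Order.TTheory GRing.Theory Num.Theory.
Import numFieldNormedType.Exports.
Local Open Scope classical_set_scope.
Local Open Scope ring_scope.

(** * Chords of the unit circle *)

(** The rational parametrization of the circle with [u] the tangent of the half angle; increasing
    [u] runs counterclockwise from the point [(-1, 0)], which is not attained. *)
Definition circx (R : realFieldType) (u : R) : R := (1 - u ^+ 2) / (1 + u ^+ 2).
Definition circy (R : realFieldType) (u : R) : R := 2 * u / (1 + u ^+ 2).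

Definition chordx (R : realFieldType) (a b t : R) := (1 - t) * circx a + t * circx b.
Definition chordy (R : realFieldType) (a b t : R) := (1 - t) * circy a + t * circy b.

(* An equation of the line through the points of the circle with parameters [a] and [b]. *)
Definition chord_eqn (R : realFieldType) (a b x y : R) : R :=
  (1 - a * b) * x + (a + b) * y - (1 + a * b).

Lemma add1sqr_gt0 (R : realFieldType) (u : R) : 0 < 1 + u ^+ 2.
Proof. by rewrite ltr_pwDl ?sqr_ge0. Qed.

Lemma add1sqr_neq0 (R : realFieldType) (u : R) : 1 + u ^+ 2 != 0.
Proof. by rewrite gt_eqF ?add1sqr_gt0. Qed.

(** The factored form shows that the order of the parameters decides on which side of the line a
    point of the circle lies. *)
Lemma chord_eqn_circ (R : realFieldType) (a b c : R) :
  chord_eqn a b (circx c) (circy c) = - 2 * ((c - a) * (c - b)) / (1 + c ^+ 2).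
Proof. rewrite /chord_eqn /circx /circy; field; exact: add1sqr_neq0. Qed.

Lemma chord_eqn_chord (R : realFieldType) (a b c d t : R) :
  chord_eqn a b (chordx c d t) (chordy c d t) =
  (1 - t) * chord_eqn a b (circx c) (circy c) + t * chord_eqn a b (circx d) (circy d).
Proof. rewrite /chord_eqn /chordx /chordy; ring. Qed.

Lemma chord_eqn_self (R : realFieldType) (a b t : R) :
  chord_eqn a b (chordx a b t) (chordy a b t) = 0.
Proof. by rewrite chord_eqn_chord !chord_eqn_circ !subrr !(mul0r, mulr0) addr0. Qed.

Lemma circ_on_circle (R : realFieldType) (u : R) : circx u ^+ 2 + circy u ^+ 2 = 1.
Proof. rewrite /circx /circy; field; exact: add1sqr_neq0. Qed.

(** The power of a point of the chord: the product of its distances to the two ends, the last factor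
    being the squared length of the chord. *)
Lemma chord_power (R : realFieldType) (a b t : R) :
  1 - chordx a b t ^+ 2 - chordy a b t ^+ 2 =
  t * (1 - t) * (4 * (a - b) ^+ 2 / ((1 + a ^+ 2) * (1 + b ^+ 2))).
Proof.
rewrite /chordx /chordy /circx /circy; field.
by rewrite !add1sqr_neq0.
Qed.

Lemma chord_power_gt0 (R : realFieldType) (a b t : R) : a < b -> 0 < t < 1 ->
  0 < 1 - chordx a b t ^+ 2 - chordy a b t ^+ 2.
Proof.
move=> ab /andP[t0 t1]; rewrite chord_power.
have ab2 : 0 < (a - b) ^+ 2 by rewrite exprn_even_gt0 //= subr_eq0 lt_eqF.
have ha := add1sqr_gt0 a; have hb := add1sqr_gt0 b.
move: ((a - b) ^+ 2) ab2 => q ab2.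
by rewrite mulr_gt0 ?divr_gt0 ?mulr_gt0 ?subr_gt0 ?ltr0n.
Qed.

Lemma chord_power_ge0 (R : realFieldType) (a b t : R) : 0 <= t <= 1 ->
  0 <= 1 - chordx a b t ^+ 2 - chordy a b t ^+ 2.
Proof.
move=> /andP[t0 t1]; rewrite chord_power.
have ha := ltW (add1sqr_gt0 a); have hb := ltW (add1sqr_gt0 b).
move: ((a - b) ^+ 2) (sqr_ge0 (a - b)) => q ab2.
by rewrite mulr_ge0 ?divr_ge0 ?mulr_ge0 ?subr_ge0 ?sqr_ge0 ?ler0n.
Qed.

Lemma circ_inj (R : realFieldType) (a b : R) :
  circx a = circx b -> circy a = circy b -> a = b.
Proof.
have E (u : R) : circy u = u * (1 + circx u).
  rewrite /circx /circy; field; exact: add1sqr_neq0.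
have P (u : R) : 1 + circx u != 0.
  have -> : 1 + circx u = 2 / (1 + u ^+ 2).
    rewrite /circx; field; exact: add1sqr_neq0.
  by rewrite mulf_neq0 ?invr_eq0 ?add1sqr_neq0 ?pnatr_eq0.
by move=> hx; rewrite !E hx => /(mulIf (P b)).
Qed.

Lemma chord_inj (R : realFieldType) (a b s t : R) : a != b ->
  chordx a b s = chordx a b t -> chordy a b s = chordy a b t -> s = t.
Proof.
move=> ab hx hy; apply/eqP; apply: contraNT ab; rewrite -subr_eq0 => st.
have Ex : (s - t) * (circx b - circx a) = 0.
  by move: hx; rewrite /chordx => hx; apply/eqP; rewrite -subr_eq0; apply/eqP; lra.
have Ey : (s - t) * (circy b - circy a) = 0.
  by move: hy; rewrite /chordy => hy; apply/eqP; rewrite -subr_eq0; apply/eqP; lra.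
move/eqP: Ex; rewrite mulf_eq0 (negbTE st) subr_eq0 /= => /eqP Ex.
move/eqP: Ey; rewrite mulf_eq0 (negbTE st) subr_eq0 /= => /eqP Ey.
by rewrite (circ_inj Ex Ey).
Qed.

(** At the common point the equation of the line [a b] is a combination of [(c - a)(c - b)] and
    [(d - a)(d - b)] with positive weights, up to the factor [-2]. It vanishes, so either these
    products have opposite signs and the line separates [c] from [d], or both are zero. *)
Lemma chords_meet (R : realFieldType) (a b c d s t : R) :
  a < b -> c < d -> 0 < t < 1 ->
  chordx a b s = chordx c d t -> chordy a b s = chordy c d t ->
  [\/ a = c /\ b = d, [/\ a < c, c < b & b < d] | [/\ c < a, a < d & d < b]].
Proof.
move=> ab cd /andP[t0 t1] hx hy.
have := chord_eqn_self a b s; rewrite hx hy chord_eqn_chord !chord_eqn_circ.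
set A := (c - a) * (c - b); set B := (d - a) * (d - b) => E.
have [p hp [q hq {}E]] : exists2 p, 0 < p & exists2 q, 0 < q & p * A + q * B = 0.
  exists ((1 - t) / (1 + c ^+ 2)); first by rewrite divr_gt0 ?add1sqr_gt0 ?subr_gt0.
  exists (t / (1 + d ^+ 2)); first by rewrite divr_gt0 ?add1sqr_gt0.
  apply/eqP; have : (2 : R) != 0 by rewrite pnatr_eq0.
  move=> /mulfI/inj_eq <-; rewrite mulr0 -oppr_eq0 -[X in _ == X]E; apply/eqP.
  by field; rewrite !add1sqr_neq0.
have AB : A > 0 -> B < 0.
  move=> A0; rewrite ltNge; apply/negP => B0.
  have : 0 < p * A + q * B by apply: ltr_pwDl; [exact: mulr_gt0|exact: mulr_ge0 (ltW _) _].
  by rewrite E ltxx.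
have BA : A < 0 -> B > 0.
  move=> A0; rewrite ltNge; apply/negP => B0.
  have : 0 < p * - A + q * - B.
    by apply: ltr_pwDl; rewrite ?mulr_gt0 ?mulr_ge0 ?oppr_gt0 ?oppr_ge0 // ltW.
  by rewrite !mulrN -opprD E oppr0 ltxx.
have [ca|ac|ac] := ltgtP c a.
- have A0 : 0 < A by rewrite /A nmulr_rgt0; lra.
  have B0 := AB A0; have [da|ad] := leP d a.
    have : 0 <= B by rewrite /B mulr_le0; lra.
    by rewrite leNgt B0.
  constructor 3; split => //; rewrite ltNge; apply/negP => bd.
  have : 0 <= B by rewrite /B mulr_ge0; lra.
  by rewrite leNgt B0.
- have [cb|bc|cb] := ltgtP c b.
  + have A0 : A < 0 by rewrite /A pmulr_rlt0; lra.
    have B0 := BA A0; constructor 2; split => //; rewrite ltNge; apply/negP => db.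
    have : B <= 0 by rewrite /B mulr_ge0_le0; lra.
    by rewrite leNgt B0.
  + have A0 : 0 < A by rewrite /A mulr_gt0; lra.
    have : 0 <= B by rewrite /B mulr_ge0; lra.
    by rewrite leNgt AB.
  + have B0 : 0 < B by rewrite /B mulr_gt0; lra.
    move: E; rewrite /A cb subrr mulr0 mulr0 add0r => /eqP.
    by rewrite mulf_eq0 !gt_eqF.
- constructor 1; split=> //; move: E; rewrite /A /B ac subrr mul0r mulr0 add0r => /eqP.
  by rewrite !mulf_eq0 (gt_eqF hq) !subr_eq0 -ac (gt_eqF cd) /= => /eqP ->.
Qed.

Lemma chords_cross (R : realFieldType) (a b c d : R) : a < c -> c < b -> b < d ->
  exists s t : R, [/\ 0 < s < 1, 0 < t < 1,
    chordx a b s = chordx c d t & chordy a b s = chordy c d t].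
Proof.
move=> ac cb bd.
(* The crossing divides each chord in the ratio of the distances of its ends to the other line;
   [A : B] and [C : D] are these ratios with denominators cleared. *)
pose A := (c - a) * (d - a) * (1 + b ^+ 2); pose B := (b - c) * (d - b) * (1 + a ^+ 2).
pose C := (c - a) * (b - c) * (1 + d ^+ 2); pose D := (d - a) * (d - b) * (1 + c ^+ 2).
have A0 : 0 < A by rewrite /A !mulr_gt0 ?add1sqr_gt0; lra.
have B0 : 0 < B by rewrite /B !mulr_gt0 ?add1sqr_gt0; lra.
have C0 : 0 < C by rewrite /C !mulr_gt0 ?add1sqr_gt0; lra.
have D0 : 0 < D by rewrite /D !mulr_gt0 ?add1sqr_gt0; lra.
have n1 : A + B != 0 by rewrite gt_eqF; lra.
have n2 : C + D != 0 by rewrite gt_eqF; lra.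
exists (A / (A + B)), (C / (C + D)); split.
- by rewrite divr_gt0 ?ltr_pdivrMr /=; lra.
- by rewrite divr_gt0 ?ltr_pdivrMr /=; lra.
- rewrite /chordx /circx; move: n1 n2; rewrite /A /B /C /D => n1 n2.
  by field; rewrite n1 n2 !add1sqr_neq0.
- rewrite /chordy /circy; move: n1 n2; rewrite /A /B /C /D => n1 n2.
  by field; rewrite n1 n2 !add1sqr_neq0.
Qed.

Lemma chord_eqn_dir (R : realFieldType) (a b c d : R) :
  (1 - a * b) * (circx d - circx c) + (a + b) * (circy d - circy c) =
  - 2 * ((d - a) * (d - b) / (1 + d ^+ 2) - (c - a) * (c - b) / (1 + c ^+ 2)).
Proof.
transitivity (chord_eqn a b (circx d) (circy d) - chord_eqn a b (circx c) (circy c)).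
  rewrite /chord_eqn; ring.
by rewrite !chord_eqn_circ; field; rewrite !add1sqr_neq0.
Qed.

(** The linear part of the equation of [c d] kills the direction of [c d], and is nonzero on that of
    [a b] because [a] and [b] lie on opposite sides. This isolates [p]; exchanging the chords
    isolates [q]. *)
Lemma chords_transverse (R : realFieldType) (a b c d p q : R) : a < c -> c < b -> b < d ->
  p * (circx b - circx a) + q * (circx d - circx c) = 0 ->
  p * (circy b - circy a) + q * (circy d - circy c) = 0 -> p = 0 /\ q = 0.
Proof.
move=> ac cb bd hx hy.
have K e f : p * ((1 - e * f) * (circx b - circx a) + (e + f) * (circy b - circy a)) +
    q * ((1 - e * f) * (circx d - circx c) + (e + f) * (circy d - circy c)) = 0.
  transitivity ((1 - e * f) * (p * (circx b - circx a) + q * (circx d - circx c)) +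
    (e + f) * (p * (circy b - circy a) + q * (circy d - circy c))); first by ring.
  by rewrite hx hy !mulr0 addr0.
have two : (- 2 : R) != 0 by rewrite oppr_eq0 pnatr_eq0.
split.
- have := K c d; rewrite !chord_eqn_dir !subrr !(mulr0, mul0r) subrr mulr0 mulr0 addr0.
  move/eqP; rewrite !mulf_eq0 (negbTE two) /= => /orP[/eqP //|].
  rewrite lt_eqF // subr_lt0 (@lt_trans _ _ 0) //.
    by rewrite pmulr_llt0 ?invr_gt0 ?add1sqr_gt0 // pmulr_rlt0; lra.
  by rewrite divr_gt0 ?add1sqr_gt0 // nmulr_rgt0; lra.
- have := K a b; rewrite !chord_eqn_dir !subrr !(mulr0, mul0r) subrr mulr0 mulr0 add0r.
  move/eqP; rewrite !mulf_eq0 (negbTE two) /= => /orP[/eqP //|].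
  rewrite gt_eqF // subr_gt0 (@lt_trans _ _ 0) //.
    by rewrite pmulr_llt0 ?invr_gt0 ?add1sqr_gt0 // pmulr_rlt0; lra.
  by rewrite divr_gt0 ?add1sqr_gt0 // pmulr_rgt0; lra.
Qed.

(** As [chord_eqn a b x y = (x - 1) + (a + b) y - a b (x + 1)], the expression is the determinant
    with rows [(1, a + b, a b)], [(1, c + d, c d)], [(1, e + f, e f)]. If it were nonzero, then
    [y = 0] and [x = -1], where [chord_eqn] equals [-2]. *)
Lemma concurrent_det (R : realFieldType) (a b c d e f x y : R) :
  chord_eqn a b x y = 0 -> chord_eqn c d x y = 0 -> chord_eqn e f x y = 0 ->
  (c + d) * (e * f) - (e + f) * (c * d) - (a + b) * (e * f) + (e + f) * (a * b) +
  (a + b) * (c * d) - (c + d) * (a * b) = 0.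
Proof.
rewrite /chord_eqn => h1 h2 h3; set D := (X in X = 0).
have Dy : D * y = 0.
  transitivity ((a * b - e * f) * ((1 - a * b) * x + (a + b) * y - (1 + a * b)
      - ((1 - c * d) * x + (c + d) * y - (1 + c * d))) -
    (a * b - c * d) * ((1 - a * b) * x + (a + b) * y - (1 + a * b) -
      ((1 - e * f) * x + (e + f) * y - (1 + e * f)))); first by rewrite /D; ring.
  by rewrite h1 h2 h3 subrr !mulr0 subrr.
have Dx : D * (x + 1) = 0.
  transitivity ((a + b - (e + f)) * ((1 - a * b) * x + (a + b) * y - (1 + a * b)
      - ((1 - c * d) * x + (c + d) * y - (1 + c * d))) -
    (a + b - (c + d)) * ((1 - a * b) * x + (a + b) * y - (1 + a * b) -
      ((1 - e * f) * x + (e + f) * y - (1 + e * f)))); first by rewrite /D; ring.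
  by rewrite h1 h2 h3 subrr !mulr0 subrr.
apply/eqP; apply: contraT => D0.
move/eqP: Dy; rewrite mulf_eq0 (negbTE D0) /= => /eqP y0.
move/eqP: Dx; rewrite mulf_eq0 (negbTE D0) /= addr_eq0 => /eqP x1.
by move: h1; rewrite y0 x1; lra.
Qed.

(* The determinant is positive because it is dominated by its term [x6 x5 (x3 - x2)]. *)
Lemma growing_not_concurrent (R : realFieldType) (x1 x2 x3 x4 x5 x6 x y : R) :
  1 <= x1 -> x1 + 1 <= x2 -> x2 + 1 <= x3 -> x3 + 1 <= x4 ->
  10 * x4 ^+ 3 <= x5 -> 10 * x5 ^+ 3 <= x6 ->
  chord_eqn x1 x4 x y = 0 -> chord_eqn x2 x5 x y = 0 -> chord_eqn x3 x6 x y = 0 -> False.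
Proof.
move=> h1 h12 h23 h34 h45 h56 e1 e2 e3.
have := concurrent_det e1 e2 e3; apply/eqP; rewrite gt_eqF //.
have le_cube (z : R) : 1 <= z -> z ^+ 2 <= z ^+ 3 /\ z <= z ^+ 2.
  by move=> hz; rewrite [z ^+ 3]exprSr ler_peMr ?sqr_ge0 // expr2 ler_peMr //; lra.
have [h4c h4s] := le_cube x4 ltac:(lra).
have h45' : x4 < x5 by lra.
have [h5c h5s] := le_cube x5 ltac:(lra).
(* [K] is the coefficient of [x6] in the determinant; each of the six other monomials has absolute
   value at most [x5 ^+ 3]. *)
pose K := x5 * (x3 - x2) - x4 * (x3 - x1) + x3 * (x2 - x1).
have K1 : 1 <= K.
  have p1 : x5 <= x5 * (x3 - x2) by rewrite ler_peMr; lra.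
  have p2 : x4 * (x3 - x1) <= x4 ^+ 2 by rewrite expr2 ler_wpM2l; lra.
  have p3 : 0 <= x3 * (x2 - x1) by rewrite mulr_ge0; lra.
  by rewrite /K; lra.
have prod3 (p q r : R) : 0 <= p <= x5 -> 0 <= q <= x5 -> 0 <= r <= x5 ->
    0 <= p * q * r <= x5 ^+ 3.
  move=> /andP[? ?] /andP[? ?] /andP[? ?]; rewrite !mulr_ge0 //=.
  by rewrite exprSr expr2 !ler_pM ?mulr_ge0.
have r1 : 0 <= x3 * x2 * x5 <= x5 ^+ 3 by apply: prod3; lra.
have r2 : 0 <= x2 * x1 * x4 <= x5 ^+ 3 by apply: prod3; lra.
have r3 : 0 <= x5 * x1 * x4 <= x5 ^+ 3 by apply: prod3; lra.
have r4 : 0 <= x3 * x1 * x4 <= x5 ^+ 3 by apply: prod3; lra.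
have r5 : 0 <= x1 * x2 * x5 <= x5 ^+ 3 by apply: prod3; lra.
have r6 : 0 <= x4 * x2 * x5 <= x5 ^+ 3 by apply: prod3; lra.
have x6K : x6 <= x6 * K by rewrite ler_peMr //; lra.
suff -> : (x2 + x5) * (x3 * x6) - (x3 + x6) * (x2 * x5) - (x1 + x4) * (x3 * x6) +
  (x3 + x6) * (x1 * x4) + (x1 + x4) * (x2 * x5) - (x2 + x5) * (x1 * x4) =
  x6 * K + (- (x3 * x2 * x5) + x3 * x1 * x4 + x1 * x2 * x5 + x4 * x2 * x5
            - x2 * x1 * x4 - x5 * x1 * x4) by lra.
by rewrite /K; ring.
Qed.

(** The recursion provides exactly the growth that [growing_not_concurrent] requires. *)
Fixpoint fast (k : nat) : nat := if k is k'.+1 then (10 * fast k' ^ 3)%N else 1%N.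

Lemma fast_gt0 k : (0 < fast k)%N.
Proof. by elim: k => //= k IH; rewrite muln_gt0 expn_gt0 IH. Qed.

Lemma fast_growth i j : (i < j)%N -> (10 * fast i ^ 3 <= fast j)%N.
Proof.
elim: j => // j IH; rewrite ltnS leq_eqVlt => /orP[/eqP -> //|/IH ij] /=.
apply: leq_trans ij _; have := fast_gt0 j; rewrite !expnS expn0; nia.
Qed.

Lemma fast_lt i j : (i < j)%N -> (fast i < fast j)%N.
Proof.
move=> /fast_growth; apply: leq_trans; have := fast_gt0 i; rewrite !expnS expn0; nia.
Qed.

Definition param (R : realFieldType) (k : nat) : R := (fast k)%:R.

Lemma param_lt (R : realFieldType) i j : (param R i < param R j) = (i < j)%N.
Proof.
rewrite /param ltr_nat; have [/fast_lt -> //|/fast_lt h|->] := ltngtP i j.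
  by apply/negbTE; rewrite -leqNgt ltnW.
by rewrite ltnn.
Qed.

Lemma param_inj (R : realFieldType) : injective (param R).
Proof.
move=> i j ij; apply/eqP; rewrite eqn_leq leqNgt -(param_lt R) ij ltxx /=.
by rewrite leqNgt -(param_lt R) ij ltxx.
Qed.

Definition ptx (R : realFieldType) (a b : nat) (t : R) := chordx (param R a) (param R b) t.
Definition pty (R : realFieldType) (a b : nat) (t : R) := chordy (param R a) (param R b) t.

Lemma nat_chords_meet (R : realFieldType) a b c d (s t : R) :
  (a < b)%N -> (c < d)%N -> 0 < t < 1 ->
  ptx a b s = ptx c d t -> pty a b s = pty c d t ->
  [\/ a = c /\ b = d, interleaved a b c d | interleaved c d a b].
Proof.
move=> ab cd t01 hx hy.
have pab : param R a < param R b by rewrite param_lt.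
have pcd : param R c < param R d by rewrite param_lt.
have [[/param_inj -> /param_inj ->]|[]|[]] := chords_meet pab pcd t01 hx hy.
- by constructor 1.
- by rewrite !param_lt => h1 h2 h3; constructor 2; apply/and3P.
- by rewrite !param_lt => h1 h2 h3; constructor 3; apply/and3P.
Qed.

(** The three interleavings amount to [a < c < e < b < d < f]. *)
Lemma nat_chords_sorted (R : realFieldType) a b c d e f (x y : R) :
  interleaved a b c d -> interleaved c d e f -> interleaved a b e f ->
  chord_eqn (param R a) (param R b) x y = 0 ->
  chord_eqn (param R c) (param R d) x y = 0 ->
  chord_eqn (param R e) (param R f) x y = 0 -> False.
Proof.
move=> /and3P[h1 h2 h3] /and3P[h4 h5 h6] /and3P[h7 h8 h9].
have step i j : (i < j)%N -> param R i + 1 <= param R j.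
  by move=> ij; rewrite /param natr1 ler_nat fast_lt.
have jump i j : (i < j)%N -> 10 * param R i ^+ 3 <= param R j.
  by move=> ij; rewrite /param -natrX -(natrM _ 10) ler_nat fast_growth.
apply: growing_not_concurrent; [|exact: step..|exact: jump|exact: jump].
by rewrite /param ler1n fast_gt0.
Qed.

Lemma nat_chords_concurrent (R : realFieldType) a b c d e f (r s t : R) :
  (a < b)%N -> (c < d)%N -> (e < f)%N -> 0 < r < 1 -> 0 < s < 1 -> 0 < t < 1 ->
  ptx a b r = ptx c d s -> pty a b r = pty c d s ->
  ptx a b r = ptx e f t -> pty a b r = pty e f t ->
  [\/ a = c /\ b = d, a = e /\ b = f | c = e /\ d = f].
Proof.
move=> ab cd ef hr hs ht x1 y1 x2 y2.
have E1 := chord_eqn_self (param R a) (param R b) r.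
have E2 := chord_eqn_self (param R c) (param R d) s.
have E3 := chord_eqn_self (param R e) (param R f) t.
move: (E1) E2 E3; rewrite -!/(ptx _ _ _) -!/(pty _ _ _) -x1 -y1 -x2 -y2 => {}E1 E2 E3.
have [?|i1|i1] := nat_chords_meet ab cd hs x1 y1; first by constructor 1.
all: have [?|i2|i2] := nat_chords_meet ab ef ht x2 y2; first by constructor 2.
all: have [||?|i3|i3] := @nat_chords_meet R c d e f s t cd ef ht; rewrite -?x1 -?y1 //;
  first by constructor 3.
(* Each pair of chords is interleaved in one of two directions. Of the eight combinations, six order
   the three chords linearly and two are cyclic, hence contradictory. *)
all: exfalso.
- exact: (nat_chords_sorted i1 i3 i2 E1 E2 E3).
- exact: (nat_chords_sorted i2 i3 i1 E1 E3 E2).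
- case/and3P: i1 i2 i3 => ? ? ? /and3P[? ? ?] /and3P[? ? ?]; lia.
- exact: (nat_chords_sorted i2 i1 i3 E3 E1 E2).
- exact: (nat_chords_sorted i1 i2 i3 E2 E1 E3).
- case/and3P: i1 i2 i3 => ? ? ? /and3P[? ? ?] /and3P[? ? ?]; lia.
- exact: (nat_chords_sorted i3 i2 i1 E2 E3 E1).
- exact: (nat_chords_sorted i3 i1 i2 E3 E2 E1).
Qed.

(** * Arcs on the sphere *)

Definition row3 (R : realType) (x y z : R) : 'rV[R]_3 :=
  \row_(i < 3) nth 0 [:: x; y; z] i.

Lemma row3_inj (R : realType) (x y z x' y' z' : R) :
  row3 x y z = row3 x' y' z' -> [/\ x = x', y = y' & z = z'].
Proof.
move=> /rowP h; split.
- by have := h (@Ordinal 3 0 isT); rewrite !mxE.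
- by have := h (@Ordinal 3 1 isT); rewrite !mxE.
- by have := h (@Ordinal 3 2 isT); rewrite !mxE.
Qed.

Lemma row3_sphere (R : realType) (x y z : R) :
  on_sphere (row3 x y z) <-> x ^+ 2 + y ^+ 2 + z ^+ 2 = 1.
Proof. by rewrite /on_sphere !big_ord_recl big_ord0 !mxE /= addr0 addrA. Qed.

Lemma continuous_row3 (R : realType) (x y z : R -> R) (t : R) :
  {for t, continuous x} -> {for t, continuous y} -> {for t, continuous z} ->
  {for t, continuous (fun s => row3 (x s) (y s) (z s))}.
Proof.
move=> hx hy hz.
have -> : (fun s => row3 (x s) (y s) (z s)) =
    (fun s => x s *: row3 1 0 0 + y s *: row3 0 1 0 + z s *: row3 0 0 1).
  apply/funext => s; apply/rowP => i; rewrite !mxE.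
  by case: i => -[|[|[|//]]] /= _; rewrite !(mulr0, mulr1, addr0, add0r).
by apply: continuousD; [apply: continuousD|];
  apply: (@continuousZr_tmp R 'rV[R]_3 R) => //.
Qed.

Lemma derivable_row3 (R : realType) (x y z : R -> R) (t : R) :
  derivable x t 1 -> derivable y t 1 -> derivable z t 1 ->
  derivable (fun s => row3 (x s) (y s) (z s)) t 1 /\
  'D_1 (fun s => row3 (x s) (y s) (z s)) t = row3 ('D_1 x t) ('D_1 y t) ('D_1 z t).
Proof.
move=> hx hy hz.
have h : derivable (fun s => row3 (x s) (y s) (z s)) t 1.
  apply/derivable_mxP => i j.
  have : derivable (fun s => nth 0 [:: x s; y s; z s] j) t 1.
    case: j => -[|[|[|k]]] hj; [exact: hx|exact: hy|exact: hz|by case: (notF hj)].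
  have -> : (fun s => nth 0 [:: x s; y s; z s] j) =
      (fun s => row3 (x s) (y s) (z s) i j) by apply/funext => s; rewrite mxE.
  by [].
split=> //; rewrite derive_mx //; apply/rowP => j; rewrite !mxE.
under eq_fun do rewrite mxE.
by case: j => -[|[|[|k]]] hj; [| | |case: (notF hj)].
Qed.

Definition equator (R : realType) (k : nat) : 'rV[R]_3 :=
  row3 (circx (param R k)) (circy (param R k)) 0.

Definition height (R : realType) (p : bool) (x y : R) : R :=
  (if p then 1 else -1) * Num.sqrt (1 - x ^+ 2 - y ^+ 2).

Definition piece_arc (R : realType) (p : bool) (a b : nat) (t : R) : 'rV[R]_3 :=
  row3 (ptx a b t) (pty a b t) (height p (ptx a b t) (pty a b t)).

Lemma equator_inj (R : realType) : injective (@equator R).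
Proof. by move=> i j /row3_inj[/circ_inj h /h /param_inj]. Qed.

Lemma equator_sphere (R : realType) k : on_sphere (equator R k).
Proof. by apply/row3_sphere; rewrite expr0n addr0 circ_on_circle. Qed.

Lemma sign_sqr (R : realType) (p : bool) : (if p then 1 else -1 : R) ^+ 2 = 1.
Proof. by case: p; rewrite ?sqrrN expr1n. Qed.

Lemma piece_arc_sphere (R : realType) p a b (t : R) : 0 <= t <= 1 ->
  on_sphere (piece_arc p a b t).
Proof.
move=> ht; apply/row3_sphere; rewrite /height exprMn sign_sqr mul1r sqr_sqrtr.
  by ring.
exact: chord_power_ge0.
Qed.

Lemma height_circle (R : realType) p (u : R) : height p (circx u) (circy u) = 0.
Proof. by rewrite /height -addrA -opprD circ_on_circle subrr sqrtr0 mulr0. Qed.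

Lemma piece_arc0 (R : realType) p a b : piece_arc p a b (0 : R) = equator R a.
Proof.
by rewrite /piece_arc /ptx /pty /chordx /chordy !mul0r !subr0 !addr0 !mul1r height_circle.
Qed.

Lemma piece_arc1 (R : realType) p a b : piece_arc p a b (1 : R) = equator R b.
Proof.
by rewrite /piece_arc /ptx /pty /chordx /chordy subrr !mul0r !add0r !mul1r height_circle.
Qed.

Lemma height_gt0 (R : realType) a b (t : R) : (a < b)%N -> 0 < t < 1 ->
  0 < Num.sqrt (1 - ptx a b t ^+ 2 - pty a b t ^+ 2).
Proof. by move=> ab ht; rewrite sqrtr_gt0 chord_power_gt0 ?param_lt. Qed.

Lemma piece_arc_off_equator (R : realType) p a b (t : R) (k : nat) :
  (a < b)%N -> 0 < t < 1 -> piece_arc p a b t <> equator R k.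
Proof.
move=> ab ht /row3_inj[_ _ /eqP]; have := height_gt0 ab ht.
by case: p; rewrite /height mulf_eq0 ?oppr_eq0 oner_eq0 /= => h; rewrite gt_eqF.
Qed.

(** The height of an interior point is nonzero and its sign gives the page. *)
Lemma piece_arc_same (R : realType) p p' a b c d (s t : R) : (a < b)%N -> (c < d)%N ->
  0 < s < 1 -> 0 < t < 1 -> piece_arc p a b s = piece_arc p' c d t ->
  [/\ p = p', ptx a b s = ptx c d t & pty a b s = pty c d t].
Proof.
move=> ab cd hs ht /row3_inj[hx hy]; have := height_gt0 ab hs; have := height_gt0 cd ht.
rewrite -hx -hy /height; case: p; case: p' => // h1 h2; lra.
Qed.

Lemma piece_arc_eqE (R : realType) p a b c d (s t : R) :
  ptx a b s = ptx c d t -> pty a b s = pty c d t ->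
  piece_arc p a b s = piece_arc p c d t.
Proof. by rewrite /piece_arc => -> ->. Qed.

Lemma piece_arc_inj (R : realType) p a b (s t : R) : (a < b)%N ->
  piece_arc p a b s = piece_arc p a b t -> s = t.
Proof.
move=> ab /row3_inj[hx hy _]; apply: chord_inj hx hy.
by rewrite lt_eqF // param_lt.
Qed.

Lemma derivable_height (R : realType) p (x y : R -> R) (t : R) :
  derivable x t 1 -> derivable y t 1 -> 0 < 1 - x t ^+ 2 - y t ^+ 2 ->
  derivable (fun s => height p (x s) (y s)) t 1.
Proof.
move=> hx hy pos; apply: derivableM; first exact: derivable_cst.
have hr : derivable (fun s : R => 1 - x s ^+ 2 - y s ^+ 2) t 1.
  have -> : (fun s : R => 1 - x s ^+ 2 - y s ^+ 2) = cst 1 - x * x - y * y.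
    by apply/funext => s; rewrite /= !expr2.
  exact: (derivableB (derivableB (derivable_cst _ _ _) (derivableM hx hx)) (derivableM hy hy)).
pose r (s : R) := 1 - x s ^+ 2 - y s ^+ 2.
have dr : is_derive t 1 r ('D_1 r t) := derivableP hr.
have ds : is_derive (r t) 1 Num.sqrt (2 * Num.sqrt (r t))^-1 := is_derive1_sqrt pos.
exact: (@ex_derive _ _ _ _ _ _ _ (is_derive1_comp ds dr)).
Qed.

Lemma continuous_height (R : realType) p (x y : R -> R) (t : R) :
  {for t, continuous x} -> {for t, continuous y} ->
  {for t, continuous (fun s => height p (x s) (y s))}.
Proof.
move=> cx cy; apply: continuousM; first exact: cst_continuous.
apply: (@continuous_comp _ _ _ _ (@Num.sqrt R)); last exact: sqrt_continuous.
have -> : (fun s : R => 1 - x s ^+ 2 - y s ^+ 2) = cst 1 - x \* x - y \* y.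
  by apply/funext => s; rewrite /= !expr2.
apply: continuousB; last exact: (continuousM cy cy).
by apply: continuousB; [exact: cst_continuous|exact: (continuousM cx cx)].
Qed.

Lemma is_derive_chord (R : realType) (u v t k l : R) :
  is_derive t 1 (fun s : R => (1 - (k * s + l)) * u + (k * s + l) * v) (k * (v - u)).
Proof.
apply: is_derive_eq; rewrite ?scaler0 ?addr0 /GRing.scale /=; ring.
Qed.

Lemma continuous_piece_arc (R : realType) p a b (k l : R) :
  continuous (fun t : R => piece_arc p a b (k * t + l)).
Proof.
move=> t; have cx : continuous (fun t : R => ptx a b (k * t + l)).
  move=> s; apply/differentiable_continuous/derivable1_diffP.
  by apply: ex_derive; apply: is_derive_chord.
have cy : continuous (fun t : R => pty a b (k * t + l)).
  move=> s; apply/differentiable_continuous/derivable1_diffP.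
  by apply: ex_derive; apply: is_derive_chord.
apply: (@continuous_row3 R (fun t => ptx a b (k * t + l)) (fun t => pty a b (k * t + l))
  (fun t => height p (ptx a b (k * t + l)) (pty a b (k * t + l))) t (cx t) (cy t)).
exact: (@continuous_height R p (fun t => ptx a b (k * t + l)) (fun t => pty a b (k * t + l))
  t (cx t) (cy t)).
Qed.

(** The vertical component of the tangent stays unspecified: the horizontal ones already give
    transversality. *)
Lemma derivable_piece_arc (R : realType) p a b (k l t : R) : (a < b)%N ->
  0 < k * t + l < 1 ->
  derivable (fun s : R => piece_arc p a b (k * s + l)) t 1 /\
  exists z, 'D_1 (fun s : R => piece_arc p a b (k * s + l)) t =
    row3 (k * (circx (param R b) - circx (param R a)))
         (k * (circy (param R b) - circy (param R a))) z.
Proof.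
move=> ab ht.
have dx := is_derive_chord (circx (param R a)) (circx (param R b)) t k l.
have dy := is_derive_chord (circy (param R a)) (circy (param R b)) t k l.
have hx : derivable (fun s : R => ptx a b (k * s + l)) t 1 by apply: ex_derive.
have hy : derivable (fun s : R => pty a b (k * s + l)) t 1 by apply: ex_derive.
have hz : derivable (fun s : R => height p (ptx a b (k * s + l)) (pty a b (k * s + l))) t 1.
  apply: (@derivable_height R p _ _ t hx hy).
  by apply: chord_power_gt0; rewrite ?param_lt.
have [D ED] := derivable_row3 hx hy hz.
split=> //; rewrite ED.
have -> : 'D_1 (fun s : R => ptx a b (k * s + l)) t =
   k * (circx (param R b) - circx (param R a)) by apply: derive_val.
have -> : 'D_1 (fun s : R => pty a b (k * s + l)) t =
   k * (circy (param R b) - circy (param R a)) by apply: derive_val.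
by eexists.
Qed.

(** * The drawing *)

(** Pieces run from the smaller to the larger index, so the lower half of the rerouted edge is
    traversed backwards, from the point [2 m + 1] to the vertex [2 m - 1]. *)
Definition edge_arc (R : realType) m (e : edge m.*2.+1) (t : R) : 'rV[R]_3 :=
  let: (a, b) := (val (val e).1, val (val e).2) in
  if rerouted m a b then
    if t <= 1 / 2 then piece_arc true 2 m.*2.+1 (2 * t)
    else piece_arc false m.*2.-1 m.*2.+1 (- 2 * t + 2)
  else piece_arc (page m (a + b)) a b t.

Definition rerouted_drawing (R : realType) m : drawing R m.*2.+1 :=
  Drawing (fun v => equator R (val v)) (@edge_arc R m).

(* [owns e p a b]: the piece with end points [a < b] on page [p] is a part of the edge [e]. *)
Definition owns m (e : edge m.*2.+1) (p : bool) (a b : nat) : bool :=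
  if rerouted m (val (val e).1) (val (val e).2)
  then (a == if p then 2 else m.*2.-1)%N && (b == m.*2.+1)
  else [&& a == val (val e).1, b == val (val e).2 & p == page m (a + b)].

Lemma owns_piece m (e : edge m.*2.+1) p a b : (2 < m)%N -> owns e p a b -> piece m p a b.
Proof.
move=> hm; rewrite /owns /piece; case: e => -[[i hi] [j hj]] /= ij.
case: ifPn => [_ /andP[/eqP -> /eqP ->]|nr /and3P[/eqP -> /eqP -> /eqP ->]].
  by rewrite !eqxx leqnn andbT; case: p; lia.
by rewrite ij (ltnW hj) nr eqxx (ltn_eqF hj).
Qed.

Lemma owns_lt m (e : edge m.*2.+1) p a b : (2 < m)%N -> owns e p a b -> (a < b)%N.
Proof. by move=> hm /(owns_piece hm) /and3P[]. Qed.

Lemma edge_val_inj n (e e' : edge n) :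
  val (val e).1 = val (val e').1 -> val (val e).2 = val (val e').2 -> e = e'.
Proof.
case: e e' => -[i j] h [[i' j'] h'] /= ii jj; apply: val_inj => /=.
by rewrite (val_inj ii) (val_inj jj).
Qed.

Lemma owns_fun m (e : edge m.*2.+1) p a b a' b' :
  owns e p a b -> owns e p a' b' -> a = a' /\ b = b'.
Proof.
rewrite /owns; case: ifP => _.
  by move=> /andP[/eqP -> /eqP ->] /andP[/eqP -> /eqP ->].
by move=> /and3P[/eqP -> /eqP -> _] /and3P[/eqP -> /eqP -> _].
Qed.

Lemma owns_inj m (e e' : edge m.*2.+1) p a b : owns e p a b -> owns e' p a b -> e = e'.
Proof.
rewrite /owns; case: ifPn => [/andP[/eqP h1 /eqP h2]|_].
  move=> /andP[_ /eqP ->]; case: ifPn => [/andP[/eqP h3 /eqP h4] _|_ /and3P[_ /eqP]].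
    by apply: edge_val_inj; congruence.
  by move=> h; have := ltn_ord (val e').2; rewrite -h ltnn.
move=> /and3P[/eqP -> /eqP -> _]; case: ifPn => [_ /andP[_ /eqP]|_ /and3P[/eqP h1 /eqP h2 _]].
  by move=> h; have := ltn_ord (val e).2; rewrite h ltnn.
exact: edge_val_inj.
Qed.

Lemma edge_of_pair n i j : (i < j)%N -> (j < n)%N ->
  exists e : edge n, val (val e).1 = i /\ val (val e).2 = j.
Proof.
move=> ij jn; have hi := ltn_trans ij jn.
by exists (exist (fun p : 'I_n * 'I_n => (p.1 < p.2)%N) (Ordinal hi, Ordinal jn) ij).
Qed.

Lemma piece_owned m p a b : (2 < m)%N -> piece m p a b -> exists e, @owns m e p a b.
Proof.
move=> hm /and3P[ab bn]; case: eqP => [-> /eqP ->|bn' /andP[nr /eqP pg]].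
  have [||e [e1 e2]] := @edge_of_pair m.*2.+1 2 m.*2.-1; [lia|lia|].
  by exists e; rewrite /owns e1 e2 /rerouted !eqxx.
have [||e [e1 e2]] := @edge_of_pair m.*2.+1 a b; [lia|lia|].
by exists e; rewrite /owns e1 e2 (negbTE nr) !eqxx pg eqxx.
Qed.

Lemma owned_point (R : realType) m (e : edge m.*2.+1) p a b (s : R) :
  owns e p a b -> inside01 s ->
  exists t : R, inside01 t /\ edge_arc e t = piece_arc p a b s.
Proof.
rewrite /owns /edge_arc /inside01; case: ifP => _.
  case: p => /andP[/eqP -> /eqP ->] /andP[s0 s1].
    exists (s / 2); split; first by apply/andP; split; lra.
    by rewrite ifT; [congr piece_arc; field|lra].
  exists (1 - s / 2); split; first by apply/andP; split; lra.
  by rewrite ifF; [congr piece_arc; field|apply/negbTE; rewrite -ltNge; lra].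
by move=> /and3P[/eqP -> /eqP -> /eqP ->] hs; exists s.
Qed.

Lemma near_le (R : realType) (t c : R) : t < c -> \forall s \near t, s <= c.
Proof. by move=> tc; near=> s; apply: ltW; near: s; exact: lt_nbhsl. Unshelve. all: by end_near. Qed.

(* Away from the end points and from the point where the rerouted edge meets the
   equator, every arc is locally an affinely reparametrized piece. *)
Lemma edge_arc_local (R : realType) m (e : edge m.*2.+1) (t : R) : inside01 t ->
  edge_arc e t = equator R m.*2.+1 /\ rerouted m (val (val e).1) (val (val e).2) /\ t = 1 / 2 \/
  exists p a b k l, [/\ owns e p a b, k != 0, 0 < k * t + l < 1 &
    \forall s \near t, piece_arc p a b (k * s + l) = edge_arc e s].
Proof.
move=> /andP[t0 t1]; rewrite /owns.
have [r|nr] := boolP (rerouted m (val (val e).1) (val (val e).2)); last first.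
  right; exists (page m (val (val e).1 + val (val e).2)), (val (val e).1), (val (val e).2), 1, 0.
  rewrite !eqxx mul1r addr0 oner_eq0 t0 t1; split => //.
  by near=> s; rewrite /edge_arc (negbTE nr) mul1r addr0.
have [t2|t2|t2] := ltgtP t (1 / 2).
- right; exists true, 2%N, m.*2.+1, 2, 0; rewrite !eqxx pnatr_eq0; split=> //.
    by apply/andP; split; lra.
  near=> s; rewrite /edge_arc r addr0 ifT //.
  by near: s; exact: near_le.
- right; exists false, m.*2.-1, m.*2.+1, (-2), 2; rewrite !eqxx oppr_eq0 pnatr_eq0; split=> //.
    by apply/andP; split; lra.
  near=> s; rewrite /edge_arc r ifF //; apply/negbTE; rewrite -ltNge.
  by near: s; exact: lt_nbhsr.
- left; rewrite /edge_arc r ifT ?t2 //; split=> //.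
  by rewrite (_ : 2 * (1 / 2) = 1) ?piece_arc1 //; field.
Unshelve. all: by end_near. Qed.

(** Reduces a crossing of edges to a crossing of two chords on one page. The equatorial point
    [2 m + 1] cannot be a crossing: only the rerouted edge passes through it, as the interiors of
    pieces avoid the equator. *)
Lemma meet_pieces (R : realType) m (e1 e2 : edge m.*2.+1) (s t : R) : (2 < m)%N ->
  meet_at (rerouted_drawing R m) e1 e2 s t ->
  exists p a b c d k l k' l',
    [/\ owns e1 p a b, owns e2 p c d, [/\ k != 0, k' != 0, 0 < k * s + l < 1 & 0 < k' * t + l' < 1],
        [/\ ptx a b (k * s + l) = ptx c d (k' * t + l'),
            pty a b (k * s + l) = pty c d (k' * t + l'),
            \forall u \near s, piece_arc p a b (k * u + l) = edge_arc e1 u &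
            \forall u \near t, piece_arc p c d (k' * u + l') = edge_arc e2 u] &
        interleaved a b c d || interleaved c d a b].
Proof.
move=> hm [ne [hs [ht /= est]]].
have [[q1 [r1 _]] | [p [a [b [k [l [h1 k0 kl n1]]]]]]] := edge_arc_local e1 hs;
have [[q2 [r2 _]] | [p' [c [d [k' [l' [h2 k0' kl' n2]]]]]]] := edge_arc_local e2 ht.
- case/eqP: ne; case/andP: r1 => /eqP a1 /eqP b1; case/andP: r2 => /eqP a2 /eqP b2.
  by apply: edge_val_inj; congruence.
- have := nbhs_singleton n2; rewrite -est q1 => /piece_arc_off_equator; case => //.
  exact: owns_lt h2.
- have := nbhs_singleton n1; rewrite est q2 => /piece_arc_off_equator; case => //.
  exact: owns_lt h1.
have ab := owns_lt hm h1; have cd := owns_lt hm h2.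
have := est; rewrite -(nbhs_singleton n1) -(nbhs_singleton n2).
case/(piece_arc_same ab cd kl kl') => pp hx hy; subst p'.
exists p, a, b, c, d, k, l, k', l'; split => //.
have [[ac bd]|->|->] := nat_chords_meet ab cd kl' hx hy; rewrite ?orbT //.
by subst c d; case/eqP: ne; exact: owns_inj h1 h2.
Qed.

(** A row of the left kernel is a pair [(p, q)], and two coordinates already force it to vanish. *)
Lemma row_free_row3 (R : realType) (x y z x' y' z' : R) :
  (forall p q, p * x + q * x' = 0 -> p * y + q * y' = 0 -> p = 0 /\ q = 0) ->
  row_free (col_mx (row3 x y z) (row3 x' y' z')).
Proof.
move=> h; rewrite -kermx_eq0; apply/eqP/row_matrixP => i; rewrite row0.
have /sub_kermxP : (row i (kermx (col_mx (row3 x y z) (row3 x' y' z'))) <=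
  kermx (col_mx (row3 x y z) (row3 x' y' z')))%MS by exact: row_sub.
move: (row i _) => v; rewrite -[v]hsubmxK mul_row_col.
rewrite (mx11_scalar (lsubmx v)) (mx11_scalar (rsubmx v)) !mul_scalar_mx => /rowP hv.
have h0 := hv (@Ordinal 3 0 isT); have h1 := hv (@Ordinal 3 1 isT).
rewrite !mxE /= in h0 h1; rewrite !mxE /=.
have [-> ->] := h _ _ h0 h1.
by rewrite !raddf0 row_mx0.
Qed.

Lemma edge_arc_sphere (R : realType) m (e : edge m.*2.+1) (t : R) : in01 t ->
  on_sphere (edge_arc e t).
Proof.
move=> /andP[t0 t1]; rewrite /edge_arc; case: ifP => _; last first.
  by apply: piece_arc_sphere; rewrite t0.
by have [t2|t2] := leP t (1 / 2); apply: piece_arc_sphere; apply/andP; split; lra.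
Qed.

Lemma edge_arc_ends (R : realType) m (e : edge m.*2.+1) :
  edge_arc e (0 : R) = equator R (val (val e).1) /\
  edge_arc e (1 : R) = equator R (val (val e).2).
Proof.
rewrite /edge_arc; case: ifP => [/andP[/eqP -> /eqP ->]|_]; last first.
  by rewrite piece_arc0 piece_arc1.
rewrite ifT; last lra.
rewrite mulr0 piece_arc0 ifF; last by apply/negbTE; rewrite -ltNge; lra.
by rewrite mulr1 addNr piece_arc0.
Qed.

Lemma edge_arc_continuous (R : realType) m (e : edge m.*2.+1) :
  {within `[0, 1], continuous (@edge_arc R m e)}.
Proof.
have [r|nr] := boolP (rerouted m (val (val e).1) (val (val e).2)); last first.
  apply: continuous_subspaceT.
  have -> : @edge_arc R m e = (fun t : R => piece_arc (page m (val (val e).1 + val (val e).2))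
      (val (val e).1) (val (val e).2) (1 * t + 0)).
    by apply/funext => t; rewrite /edge_arc (negbTE nr) mul1r addr0.
  exact: continuous_piece_arc.
have -> : `[0, 1]%classic = (`[0, (1 / 2)] `|` `[(1 / 2), 1])%classic :> set R.
  apply/seteqP; split => x /=; rewrite !in_itv /=.
    by move=> /andP[x0 x1]; case: (leP x (1 / 2)) => h; [left|right]; apply/andP; split; lra.
  by case=> /andP[x0 x1]; apply/andP; split; lra.
apply: withinU_continuous; [exact: interval_closed|exact: interval_closed| |].
  apply: (@subspace_eq_continuous _ _ _ (fun t : R => piece_arc true 2 m.*2.+1 (2 * t + 0))).
    move=> t; rewrite inE /= in_itv /= => /andP[t0 t1].
    by rewrite /from_subspace /= /edge_arc r t1 addr0.
  apply: continuous_subspaceT; exact: continuous_piece_arc.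
apply: (@subspace_eq_continuous _ _ _ (fun t : R => piece_arc false m.*2.-1 m.*2.+1 (- 2 * t + 2))).
  move=> t; rewrite inE /= in_itv /= => /andP[t0 t1].
  rewrite /from_subspace /= /edge_arc r; case: ifP => // t2.
  (* The two closed halves overlap only here, where both formulas give the equatorial point
     [2 m + 1]. *)
  have -> : t = 1 / 2 by apply/eqP; rewrite eq_le t2 t0.
  have -> : - 2 * (1 / 2) + 2 = 1 :> R by field.
  have -> : 2 * (1 / 2) = 1 :> R by field.
  by rewrite !piece_arc1.
apply: continuous_subspaceT; exact: continuous_piece_arc.
Qed.

Lemma height_eq0 (R : realType) p a b (t : R) : (a < b)%N -> 0 <= t <= 1 ->
  height p (ptx a b t) (pty a b t) = 0 -> t = 0 \/ t = 1.
Proof.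
move=> ab /andP[t0 t1] h.
have [->|n0] := eqVneq t 0; first by left.
have [->|n1] := eqVneq t 1; first by right.
have ht : 0 < t < 1 by rewrite !lt_neqAle eq_sym n0 t0 n1 t1.
have := height_gt0 ab ht; move: h => /eqP.
by rewrite /height mulf_eq0; case: (p); rewrite ?oppr_eq0 oner_eq0 /= => /eqP ->; rewrite ltxx.
Qed.

(** The halves have heights of opposite signs, so a common point is on the equator and is an end of
    both; [t < 1] excludes the shared end [2 m + 1]. *)
Lemma rerouted_halves_disjoint (R : realType) m (s t : R) : (2 < m)%N ->
  0 <= s <= 1 -> 0 <= t < 1 ->
  piece_arc true 2 m.*2.+1 s <> piece_arc false m.*2.-1 m.*2.+1 t.
Proof.
move=> hm hs /andP[t0 t1] E.
have := E => /row3_inj[hx hy]; rewrite -hx -hy /height mulN1r mul1r => hz.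
have z0 : height true (ptx 2 m.*2.+1 s) (pty 2 m.*2.+1 s) = 0 by rewrite /height; lra.
have z1 : height false (ptx m.*2.-1 m.*2.+1 t) (pty m.*2.-1 m.*2.+1 t) = 0.
  by rewrite -hx -hy /height; move: z0; rewrite /height; lra.
have t0' : t = 0.
  have wn : (m.*2.-1 < m.*2.+1)%N by lia.
  have ht : 0 <= t <= 1 by rewrite t0 ltW.
  by have [//|t1'] := height_eq0 wn ht z1; lra.
move: E; rewrite t0' piece_arc0.
have n2 : (2 < m.*2.+1)%N by lia.
have [->|->] := height_eq0 n2 hs z0.
  by rewrite piece_arc0 => /equator_inj; lia.
by rewrite piece_arc1 => /equator_inj; lia.
Qed.

Lemma edge_arc_inj (R : realType) m (e : edge m.*2.+1) (s t : R) : (2 < m)%N ->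
  in01 s -> in01 t -> edge_arc e s = edge_arc e t -> s = t.
Proof.
move=> hm /andP[s0 s1] /andP[t0 t1]; rewrite /edge_arc; case: ifP => _; last first.
  by apply: piece_arc_inj; case: e => -[].
have [s2|s2] := leP s (1 / 2); have [t2|t2] := leP t (1 / 2).
- by move=> /piece_arc_inj h; have : 2 * s = 2 * t by [apply: h; lia]; lra.
- by move=> /rerouted_halves_disjoint; case=> //; apply/andP; split; lra.
- by move=> /esym/rerouted_halves_disjoint; case=> //; apply/andP; split; lra.
- by move=> /piece_arc_inj h; have : - 2 * s + 2 = - 2 * t + 2 by [apply: h; lia]; lra.
Qed.

Lemma edge_arc_avoids (R : realType) m (e : edge m.*2.+1) (t : R) (v : 'I_m.*2.+1) :
  (2 < m)%N -> inside01 t -> edge_arc e t != equator R v.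
Proof.
move=> hm ht; apply/eqP.
have [[-> _] /equator_inj h|[p [a [b [k [l [ho k0 kl n]]]]]]] := edge_arc_local e ht.
  by have := ltn_ord v; rewrite -h ltnn.
by rewrite -(nbhs_singleton n); apply: piece_arc_off_equator => //; exact: owns_lt ho.
Qed.

Lemma meet_transverse (R : realType) m (e1 e2 : edge m.*2.+1) (s t : R) : (2 < m)%N ->
  meet_at (rerouted_drawing R m) e1 e2 s t ->
  [/\ derivable (edge_arc e1) s 1, derivable (edge_arc e2) t 1 &
      row_free (col_mx ('D_1 (edge_arc e1) s) ('D_1 (edge_arc e2) t))].
Proof.
move=> hm /(meet_pieces hm) [p [a [b [c [d [k [l [k' [l' []]]]]]]]]].
move=> h1 h2 [k0 k0' kl kl'] [_ _ n1 n2] il.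
have [d1 [z1 D1]] := derivable_piece_arc p (owns_lt hm h1) kl.
have [d2 [z2 D2]] := derivable_piece_arc p (owns_lt hm h2) kl'.
split; [exact: near_eq_derivable n1 d1|exact: near_eq_derivable n2 d2|].
rewrite -(near_eq_derive (1 : R^o) n1) -(near_eq_derive (1 : R^o) n2) D1 D2.
apply: row_free_row3 => u v; rewrite !mulrA => hx hy.
suff [/eqP hu /eqP hv] : u * k = 0 /\ v * k' = 0.
  by move: hu hv; rewrite !mulf_eq0 (negbTE k0) (negbTE k0') !orbF => /eqP -> /eqP ->.
case/orP: il => /and3P[i1 i2 i3].
  by apply: (chords_transverse _ _ _ hx hy); rewrite param_lt.
by rewrite addrC in hx; rewrite addrC in hy;
   apply/and_comm; apply: (chords_transverse _ _ _ hx hy); rewrite param_lt.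
Qed.

(** A third edge would contribute a third chord through the same point, against
    [nat_chords_concurrent]. *)
Lemma meet_double (R : realType) m (e1 e2 e3 : edge m.*2.+1) (s t u : R) : (2 < m)%N ->
  meet_at (rerouted_drawing R m) e1 e2 s t -> e3 != e1 -> e3 != e2 -> inside01 u ->
  edge_arc e3 u != edge_arc e1 s.
Proof.
move=> hm M12 ne1 ne2 hu; apply/eqP => E.
have [ne [hs [ht /= est]]] := M12.
have M13 : meet_at (rerouted_drawing R m) e1 e3 s u by rewrite /meet_at eq_sym.
have M23 : meet_at (rerouted_drawing R m) e2 e3 t u by rewrite /meet_at eq_sym /= -est.
have [p [a [b [c [d [k [l [k' [l' []]]]]]]]]] := meet_pieces hm M12.
move=> h1 h2 [k0 k0' kl kl'] [hx hy n1 n2] il.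
have [f [g hg]] : exists f g, owns e3 p f g /\
   exists v, [/\ 0 < v < 1, ptx a b (k * s + l) = ptx f g v & pty a b (k * s + l) = pty f g v].
  have [[q1 [_ r2]] | [q [f [g [i [j [h3 i0 ij n3]]]]]]] := edge_arc_local e3 hu.
    have := nbhs_singleton n1; rewrite -E q1 => /piece_arc_off_equator; case=> //.
    exact: owns_lt h1.
  have ab := owns_lt hm h1; have fg := owns_lt hm h3.
  have := E; rewrite -(nbhs_singleton n1) -(nbhs_singleton n3) => /esym.
  case/(piece_arc_same ab fg kl ij) => pq hx' hy'; subst q.
  by exists f, g; split=> //; exists (i * u + j).
case: hg => h3 [v [hv hx' hy']].
have [[ac bd]|[af bg]|[cf dg]] := nat_chords_concurrent (owns_lt hm h1) (owns_lt hm h2)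
  (owns_lt hm h3) kl kl' hv hx hy hx' hy'.
- by subst; case/eqP: ne; exact: owns_inj h1 h2.
- by subst; case/eqP: ne1; exact: owns_inj h3 h1.
- by subst; case/eqP: ne2; exact: owns_inj h3 h2.
Qed.

(** * Crossing points and quadruples of end points *)

Definition crosses_at (R : realType) m (a c b d : nat) (x : 'rV[R]_3) : Prop :=
  exists p (s t : R), [/\ piece m p a b && piece m p c d, 0 < s < 1, 0 < t < 1,
    x = piece_arc p a b s & x = piece_arc p c d t].

Lemma piece_lt m p a b : piece m p a b -> (a < b)%N. Proof. by case/and3P. Qed.

Lemma piece_page m p p' a b : (2 < m)%N -> piece m p a b -> piece m p' a b -> p = p'.
Proof.
move=> hm /and3P[_ _ h] /and3P[_ _]; move: h; case: ifP => _.
  by case: p; case: p' => // /eqP -> /eqP; lia.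
by move=> /andP[_ /eqP ->] /andP[_ /eqP ->].
Qed.

Lemma crosses_at_exists (R : realType) m a c b d : piece_crossing m a c b d ->
  exists x : 'rV[R]_3, crosses_at m a c b d x.
Proof.
case/andP => /and3P[ac cb bd] /existsP[p hp].
rewrite -(param_lt R) in ac; rewrite -(param_lt R) in cb; rewrite -(param_lt R) in bd.
have [s [t [hs ht hx hy]]] := chords_cross ac cb bd.
exists (piece_arc p a b s), p, s, t; split => //.
exact: piece_arc_eqE.
Qed.

(** Subtracting two solutions gives a vanishing combination of the chord directions, which
    [chords_transverse] makes trivial. *)
Lemma crosses_at_unique (R : realType) m a c b d (x y : 'rV[R]_3) : (2 < m)%N ->
  piece_crossing m a c b d -> crosses_at m a c b d x -> crosses_at m a c b d y -> x = y.
Proof.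
move=> hm /andP[/and3P[ac cb bd] _] [p [s [t [/andP[hp hp2] hs ht -> E]]]].
move=> [p' [s' [t' [/andP[hp' hp2'] hs' ht' -> E']]]].
have pp := piece_page hm hp hp'; subst p'.
move: E E' => /row3_inj[hx hy _] /row3_inj[hx' hy' _].
suff -> : s = s' by [].
have ex : (s - s') * (circx (param R b) - circx (param R a)) +
          (t' - t) * (circx (param R d) - circx (param R c)) = 0.
  by move: hx hx'; rewrite /ptx /chordx; lra.
have ey : (s - s') * (circy (param R b) - circy (param R a)) +
          (t' - t) * (circy (param R d) - circy (param R c)) = 0.
  by move: hy hy'; rewrite /pty /chordy; lra.
rewrite -(param_lt R) in ac; rewrite -(param_lt R) in cb; rewrite -(param_lt R) in bd.
have [] := chords_transverse ac cb bd ex ey.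
by move=> /eqP; rewrite subr_eq0 => /eqP.
Qed.

Lemma crosses_at_inj (R : realType) m a c b d a' c' b' d' (x : 'rV[R]_3) : (2 < m)%N ->
  piece_crossing m a c b d -> piece_crossing m a' c' b' d' ->
  crosses_at m a c b d x -> crosses_at m a' c' b' d' x ->
  [/\ a = a', c = c', b = b' & d = d'].
Proof.
move=> hm /andP[/and3P[ac cb bd] _] /andP[/and3P[ac' cb' bd'] _].
move=> [p [s [t [/andP[hp hp2] hs ht Es Et]]]] [p' [s' [t' [/andP[hp' hp2'] hs' ht' Es' Et']]]].
have ab := piece_lt hp; have cd := piece_lt hp2.
have ab' := piece_lt hp'; have cd' := piece_lt hp2'.
have [_ x1 y1] := piece_arc_same ab cd hs ht (etrans (esym Es) Et).
have [_ x2 y2] := piece_arc_same ab ab' hs hs' (etrans (esym Es) Es').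
have [_ x3 y3] := piece_arc_same ab cd' hs ht' (etrans (esym Es) Et').
(* Each chord of the second pair passes through the crossing of the first pair, hence equals one of
   its chords; [a < c] and [a' < c'] then rule out an exchange. *)
have C1 := nat_chords_concurrent ab cd ab' hs ht hs' x1 y1 x2 y2.
have C2 := nat_chords_concurrent ab cd cd' hs ht ht' x1 y1 x3 y3.
move: C1 C2; clear -ac cb bd ac' cb' bd'.
by case=> -[? ?]; case=> -[? ?]; split; lia.
Qed.

Lemma is_crossing_pieces (R : realType) m (x : 'rV[R]_3) : (2 < m)%N ->
  is_crossing (rerouted_drawing R m) x <->
  exists a c b d, piece_crossing m a c b d /\ crosses_at m a c b d x.
Proof.
move=> hm; split.
  move=> [e1 [e2 [s [t [M /= <-]]]]].
  have [p [a [b [c [d [k [l [k' [l' []]]]]]]]]] := meet_pieces hm M.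
  move=> h1 h2 [k0 k0' kl kl'] [hx hy n1 n2] il.
  have P1 := owns_piece hm h1; have P2 := owns_piece hm h2.
  rewrite -(nbhs_singleton n1); case/orP: il => il.
    exists a, c, b, d; split.
      by apply/andP; split=> //; apply/existsP; exists p; rewrite P1.
    exists p, (k * s + l), (k' * t + l'); split=> //; first by rewrite P1.
    exact: piece_arc_eqE.
  exists c, a, d, b; split.
    by apply/andP; split=> //; apply/existsP; exists p; rewrite P1 P2.
  exists p, (k' * t + l'), (k * s + l); split=> //; first by rewrite P1 P2.
  exact: piece_arc_eqE.
move=> [a [c [b [d [/andP[/and3P[ac cb bd] _] [p [s [t [/andP[P1 P2] hs ht E1 E2]]]]]]]]].
have [e1 h1] := piece_owned hm P1; have [e2 h2] := piece_owned hm P2.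
have [s' [hs' E1']] := owned_point h1 hs; have [t' [ht' E2']] := owned_point h2 ht.
exists e1, e2, s', t'; rewrite /= E1' -E1; split=> //.
split; last by rewrite /= E1' E2' -E1 -E2.
by apply/eqP => ee; subst e2; have [ca _] := owns_fun h1 h2; rewrite ca ltnn in ac.
Qed.

Lemma edge_crossed_owns (R : realType) m a c b d p (e1 e2 : edge m.*2.+1) : (2 < m)%N ->
  interleaved a b c d -> owns e1 p a b -> owns e2 p c d ->
  edge_crossed (rerouted_drawing R m) e1 /\ edge_crossed (rerouted_drawing R m) e2.
Proof.
move=> hm il h1 h2; have /and3P[ac cb bd] := il.
have pc : piece_crossing m a c b d.
  apply/andP; split=> //; apply/existsP; exists p.
  by rewrite (owns_piece hm h1) (owns_piece hm h2).
have [x [p' [s [t [/andP[P1 P2] hs ht E1 E2]]]]] := crosses_at_exists R pc.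
have pp := piece_page hm P1 (owns_piece hm h1); subst p'.
have [s' [hs' E1']] := owned_point h1 hs; have [t' [ht' E2']] := owned_point h2 ht.
have ne : e1 != e2.
  by apply/eqP => ee; subst e2; have [ca _] := owns_fun h1 h2; rewrite ca ltnn in ac.
split; [exists e2, s', t'|exists e1, t', s']; split=> //=; first by rewrite E1' E2' -E1 -E2.
- by rewrite eq_sym.
- by rewrite E1' E2' -E1 -E2.
Qed.

Definition quads m : {set 'I_m.*2.+2 * 'I_m.*2.+2 * 'I_m.*2.+2 * 'I_m.*2.+2} :=
  finset (fun q : 'I_m.*2.+2 * 'I_m.*2.+2 * 'I_m.*2.+2 * 'I_m.*2.+2 =>
    piece_crossing m q.1.1.1 q.1.1.2 q.1.2 q.2).

Lemma card_quads m : (2 < m)%N -> #|quads m| = two_page_crossings m.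
Proof.
move=> hm; rewrite -piece_crossing_count // /sum4.
transitivity (\sum_(a < m.*2.+2) \sum_(c < m.*2.+2) \sum_(b < m.*2.+2)
    \sum_(d < m.*2.+2) (piece_crossing m a c b d : nat))%N.
  rewrite !pair_bigA /= -sum1_card big_mkcond; apply: eq_bigr => q _.
  by rewrite inE; case: piece_crossing.
rewrite big_mkord; apply: eq_bigr => a _; rewrite big_mkord; apply: eq_bigr => c _.
by rewrite big_mkord; apply: eq_bigr => b _; rewrite big_mkord.
Qed.

Lemma Zn_odd m : Zn m.*2.+1 = two_page_crossings m.
Proof.
rewrite /Zn /=.
have -> : uphalf m.*2 = m by lia.
have -> : ((m.*2.+1 - 1)./2 = m)%N by lia.
have -> : ((m.*2.+1 - 2)./2 = m.-1)%N by lia.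
have -> : ((m.*2.+1 - 3)./2 = m.-1)%N by lia.
have -> : (m * m * m.-1 * m.-1 = two_page_crossings m * 4)%N.
  by rewrite [RHS]mulnC two_page_crossings_eq expnS expn1; ring.
by rewrite mulnK.
Qed.

Lemma rerouted_crossing_number (R : realType) m : (2 < m)%N ->
  crossing_number_is (rerouted_drawing R m) (Zn m.*2.+1).
Proof.
move=> hm.
pose rel (q : 'I_m.*2.+2 * 'I_m.*2.+2 * 'I_m.*2.+2 * 'I_m.*2.+2) (x : 'rV[R]_3) :=
  crosses_at m q.1.1.1 q.1.1.2 q.1.2 q.2 x.
(* A crossing point is chosen for every quadruple, with the dummy value [0] outside [quads m]. *)
have ex q : {x : 'rV[R]_3 | q \in quads m -> rel q x}.
  apply: cid; have [hq|nq] := boolP (q \in quads m); last by exists 0.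
  by move: hq; rewrite inE => /(crosses_at_exists R)[x hx]; exists x.
pose f q := sval (ex q); have fP q : q \in quads m -> rel q (f q) := svalP (ex q).
exists [seq f q | q <- enum (quads m)]; split.
- rewrite map_inj_in_uniq ?enum_uniq // => q q'; rewrite !mem_enum => hq hq' ff.
  have := fP _ hq'; rewrite -ff => h'; have h := fP _ hq.
  move: hq hq'; rewrite !inE => hq hq'.
  have [] := crosses_at_inj hm hq hq' h h'.
  case: q q' {hq hq' h h' ff} => [[[a c] b] d] [[[a' c'] b'] d'] /=.
  by move=> /val_inj -> /val_inj -> /val_inj -> /val_inj ->.
- by rewrite size_map -cardE card_quads // Zn_odd.
move=> x; rewrite is_crossing_pieces //; split.
  move=> /mapP[q]; rewrite mem_enum => hq ->.
  exists q.1.1.1, q.1.1.2, q.1.2, q.2; split; last exact: fP.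
  by move: hq; rewrite inE.
move=> [a [c [b [d [pc hx]]]]].
have lt1 : (d < m.*2.+2)%N.
  by case/andP: pc => _ /existsP[p /andP[_ /and3P[]]].
have /andP[/and3P[ac cb bd] _] := pc.
have lt2 : (b < m.*2.+2)%N by lia.
have lt3 : (c < m.*2.+2)%N by lia.
have lt4 : (a < m.*2.+2)%N by lia.
have hq : (Ordinal lt4, Ordinal lt3, Ordinal lt2, Ordinal lt1) \in quads m by rewrite inE.
apply/mapP; eexists; first by rewrite mem_enum; exact: hq.
exact: crosses_at_unique hm pc hx (fP _ hq).
Qed.

Lemma rerouted_is_diagram (R : realType) m : (2 < m)%N ->
  is_diagram (rerouted_drawing R m).
Proof.
move=> hm; split.
- by move=> i j /equator_inj /val_inj.
- by move=> v; exact: equator_sphere.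
- move=> e; split; [exact: edge_arc_sphere|exact: edge_arc_continuous| | |].
  + by move=> s t; exact: edge_arc_inj.
  + exact: edge_arc_ends.
  + by move=> t v; exact: edge_arc_avoids.
- move=> e1 e2 s t M; have [d1 d2 rf] := meet_transverse hm M.
  split; [exact: d1|exact: d2|exact: rf|].
  by move=> e3 u n1 n2 hu; exact: meet_double M n1 n2 hu.
- have [s [_ _ hs]] := rerouted_crossing_number R hm.
  by exists s.
Qed.

(** * Free edges *)

(** An edge [i -- i + 1] leaves no room for an end point strictly between its ends, and for [m > 2]
    it is not the rerouted edge. *)
Lemma rerouted_based (R : realType) m : (2 < m)%N ->
  based (rerouted_drawing R m) (enum 'I_m.*2.+1).
Proof.
move=> hm e he [e' [s [t M]]].
have e12 : val (val e).2 = (val (val e).1).+1.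
  have C i j : consec (enum 'I_m.*2.+1) i j -> val j = (val i).+1.
    move=> [k []]; rewrite size_enum_ord => hk hi hj.
    have vj : nat_of_ord j = k.+1 by rewrite -hj nth_enum_ord.
    have vi : nat_of_ord i = k by rewrite -hi nth_enum_ord // ltnW.
    by rewrite /= vi vj.
  case: he => /C //; case: (e) => -[i j] /=; lia.
have [p [a [b [c [d [k [l [k' [l' [h1 h2 _ _ il]]]]]]]]]] := meet_pieces hm M.
move: h1 il; rewrite /owns /rerouted e12 /interleaved.
case: ifP => [|_ /and3P[/eqP -> /eqP -> _]]; lia.
Qed.

Lemma piece_intro m p a b : (a < b)%N -> (b <= m.*2)%N -> ~~ rerouted m a b ->
  page m (a + b) = p -> piece m p a b.
Proof.
move=> ab bn nr pg; rewrite /piece ab nr pg eqxx leqW //=.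
by have -> : (b == m.*2.+1) = false by lia.
Qed.

Lemma owns_intro m p a b (e : edge m.*2.+1) : (b <= m.*2)%N -> piece m p a b ->
  val (val e).1 = a -> val (val e).2 = b -> owns e p a b.
Proof.
move=> bn /and3P[_ _]; have -> : (b == m.*2.+1) = false by lia.
by move=> /andP[nr /eqP pg] e1 e2; rewrite /owns e1 e2 (negbTE nr) !eqxx pg eqxx.
Qed.

Lemma first_crossed (R : realType) m p a c b d (e : edge m.*2.+1) : (2 < m)%N ->
  interleaved a b c d -> (b <= m.*2)%N -> piece m p a b -> piece m p c d ->
  val (val e).1 = a -> val (val e).2 = b -> edge_crossed (rerouted_drawing R m) e.
Proof.
move=> hm il bn P1 P2 e1 e2; have [e' h2] := piece_owned hm P2.
by have [] := edge_crossed_owns R hm il (owns_intro bn P1 e1 e2) h2.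
Qed.

Lemma second_crossed (R : realType) m p a c b d (e : edge m.*2.+1) : (2 < m)%N ->
  interleaved a b c d -> (d <= m.*2)%N -> piece m p a b -> piece m p c d ->
  val (val e).1 = c -> val (val e).2 = d -> edge_crossed (rerouted_drawing R m) e.
Proof.
move=> hm il bn P1 P2 e1 e2; have [e' h1] := piece_owned hm P1.
by have [] := edge_crossed_owns R hm il h1 (owns_intro bn P2 e1 e2).
Qed.

Lemma pageT m s : (s <= m)%N || (m.*2.+1 <= s <= m.*2.+1 + m)%N -> page m s.
Proof. by move=> h; rewrite pageE; lia. Qed.

Lemma pageF m s : (m < s < m.*2.+1)%N || (m.*2.+1 + m < s < m.*2.+1.*2)%N -> page m s = false.
Proof. by move=> h; rewrite pageE; lia. Qed.

(** The edge [0 -- j] is crossed by [1 -- 2 m] if [j = 2], by the upper half of the rerouted edge if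
    [2 < j <= m], by [1 -- j + 1] if [m < j <= 2 m - 2], by [m + 2 -- 2 m] if [j = 2 m - 1], and by
    the lower half of the rerouted edge if [j = 2 m]. The fourth case needs [m + 2 < 2 m - 1], that
    is [m > 3]. *)
Lemma edge_zero_crossed (R : realType) m (e : edge m.*2.+1) : (2 < m)%N ->
  val (val e).1 = 0%N -> (1 < val (val e).2)%N -> (3 < m)%N || (val (val e).2 != 5)%N ->
  edge_crossed (rerouted_drawing R m) e.
Proof.
move=> hm e1; set j := val (val e).2 => j1 j5.
have jn : (j <= m.*2)%N by rewrite -ltnS ltn_ord.
have [j2|j2] := eqVneq j 2.
  apply: (@first_crossed R m true 0 1 2 m.*2) => //.
  - by apply/and3P; split=> //; lia.
  - by lia.
  - by apply: piece_intro; rewrite ?pageT /rerouted //; lia.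
  - by apply: piece_intro; rewrite ?pageT /rerouted //; lia.
have [jm|jm] := leqP j m.
  apply: (@first_crossed R m true 0 2 j m.*2.+1) => //.
  - by apply/and3P; split=> //; lia.
  - by apply: piece_intro; rewrite ?pageT /rerouted //; lia.
  - by apply/and3P; split; rewrite ?eqxx //; lia.
have P0 : piece m false 0 j by apply: piece_intro; rewrite ?pageF /rerouted //; lia.
have [jw|jw] := leqP j m.*2.-2.
  apply: (@first_crossed R m false 0 1 j j.+1) => //.
    by apply/and3P; split=> //; lia.
  by apply: piece_intro; rewrite ?pageF /rerouted //; lia.
have [jw'|jw'] := eqVneq j m.*2.-1.
  apply: (@first_crossed R m false 0 m.+2 j m.*2) => //.
    by apply/and3P; split=> //; lia.
  by apply: piece_intro; rewrite ?pageF /rerouted //; lia.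
apply: (@first_crossed R m false 0 m.*2.-1 j m.*2.+1) => //.
  by apply/and3P; split=> //; lia.
by apply/and3P; split; rewrite ?eqxx //; lia.
Qed.

(** * Excluding free hamiltonian cycles *)

Lemma free_cycle_rel (R : realType) n (D : drawing R n) (C : seq 'I_n) (r : rel nat) :
  symmetric r ->
  (forall e : edge n, ~ edge_crossed D e -> r (val (val e).1) (val (val e).2)) ->
  free_ham_cycle D C -> cycle r (map val C).
Proof.
move=> rs hr [[n2 [uC sC]] free]; case: C uC sC free => [//|x s] uC sC free.
rewrite /= -map_rcons path_map; apply/(pathP x) => i; rewrite size_rcons => hi.
set a := nth x (x :: rcons s x) i; set b := nth x (rcons s x) i.
have s0 : (0 < size s)%N by move: sC => /=; lia.
have ab : a != b.
  rewrite /a /b -rcons_cons nth_rcons /= hi nth_rcons.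
  have [his|his] := ltnP i (size s).
    by rewrite -[nth x s i]/(nth x (x :: s) i.+1) nth_uniq //=; lia.
  have -> : i = size s by lia.
  by rewrite eqxx -[X in _ != X]/(nth x (x :: s) 0) nth_uniq //=; lia.
have cab : consec (rcons (x :: s) x) a b.
  exists i; rewrite size_rcons /=; split; first by rewrite !ltnS; exact: hi.
    (* [consec] takes the vertices themselves as default values; both indices are in range, so the
       default can be changed to [x]. *)
    by rewrite (set_nth_default x) //= size_rcons ltnW.
  by rewrite (set_nth_default x) //= size_rcons.
have [lt|lt|eq] := ltngtP (val a) (val b); last by case/eqP: ab; exact: val_inj.
  pose e : edge n := exist (fun p : 'I_n * 'I_n => (p.1 < p.2)%N) (a, b) lt.
  by apply: (hr e); apply: free; left.
pose e : edge n := exist (fun p : 'I_n * 'I_n => (p.1 < p.2)%N) (b, a) lt.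
by rewrite /= rs; apply: (hr e); apply: free; right.
Qed.

(** Once the cycle is rotated to start at [x], its second and its last entries both equal [y],
    although they are distinct in a duplicate-free cycle of length above 2. *)
Lemma no_cycle_pendant (r : rel nat) (s : seq nat) (x y : nat) :
  (forall z, r x z -> z = y) -> symmetric r ->
  uniq s -> (2 < size s)%N -> x \in s -> ~~ cycle r s.
Proof.
move=> rx rs us ss xs; apply/negP => cs.
have [i s' E] := rot_to xs.
move: cs us ss; rewrite -(rot_cycle i) -(rot_uniq i) -(size_rot i) E.
have -> : cycle r (x :: s') = path r x (rcons s' x) by [].
rewrite rcons_path => /andP[ps' lx].
case: s' {E} ps' lx => [|z [|w s']] // /andP[/rx -> _] lx /and4P[_ yws' _ _] _.
rewrite rs in lx; have ly : last w s' = y := rx _ lx.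
by have := mem_last w s'; rewrite ly (negbTE yws').
Qed.

(** Constraints on the free edges for [m = 3], always used in symmetrized form; the rows not listed
    add no constraint. *)
Definition adjacent7 (i j : nat) : bool :=
  match i with
  | 0 => j \in [:: 1; 5]
  | 4 => j \in [:: 1; 3; 5]
  | 6 => j \in [:: 3; 5]
  | _ => true
  end%N.

(** Checked on the orders that start with [0]. By hand: [0] needs [1] and [5], [6] needs [3] and
    [5], then [4] is left with [1] and [3], which closes the hexagon [0 1 4 3 6 5] without [2]. *)
Lemma no_cycle7 (s : seq nat) : perm_eq s (iota 0 7) ->
  ~~ cycle (fun i j => adjacent7 i j && adjacent7 j i) s.
Proof.
move=> ps; have s0 : 0%N \in s by rewrite (perm_mem ps).
have [i s' E] := rot_to s0; rewrite -(rot_cycle i) E.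
have : s' \in permutations (iota 1 6).
  by rewrite mem_permutations -(perm_cons 0%N) -E perm_rot.
by move: s' {E}; apply/allP; vm_compute.
Qed.

(** Apart from the edges at [0], the forbidden ones are [1 -- 6], [2 -- 6], [4 -- 6] and [2 -- 4],
    crossed by [0 -- 2], [0 -- 3], [3 -- 5] and [1 -- 3] respectively. *)
Lemma adjacent7_free (R : realType) (e : edge 7) :
  ~ edge_crossed (rerouted_drawing R 3) e ->
  let: (i, j) := (val (val e).1, val (val e).2) in adjacent7 i j && adjacent7 j i.
Proof.
move=> he; have ij : (val (val e).1 < val (val e).2)%N by case: (e) => -[].
have jn : (val (val e).2 < 7)%N := ltn_ord _.
have z : val (val e).1 = 0%N -> (1 < val (val e).2)%N -> (val (val e).2 != 5)%N -> False.
  by move=> h1 h2 h3; apply: he; apply: edge_zero_crossed.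
have c1 : val (val e).1 = 1%N -> val (val e).2 = 6%N -> False.
  by move=> h1 h2; apply: he; apply: (@second_crossed R 3 true 0 1 2 6).
have c2 : val (val e).1 = 2%N -> val (val e).2 = 6%N -> False.
  by move=> h1 h2; apply: he; apply: (@second_crossed R 3 true 0 2 3 6).
have c3 : val (val e).1 = 4%N -> val (val e).2 = 6%N -> False.
  by move=> h1 h2; apply: he; apply: (@second_crossed R 3 true 3 4 5 6).
have c4 : val (val e).1 = 2%N -> val (val e).2 = 4%N -> False.
  by move=> h1 h2; apply: he; apply: (@second_crossed R 3 false 1 2 3 4).
move: (val (val e).1) (val (val e).2) ij jn z c1 c2 c3 c4 {he} => i j.
by case: i => [|[|[|[|[|[|[|i]]]]]]]; case: j => [|[|[|[|[|[|[|j]]]]]]] //= _ _ z c1 c2 c3 c4;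
  first [case: (z erefl isT isT) | case: (c1 erefl erefl) | case: (c2 erefl erefl) |
         case: (c3 erefl erefl) | case: (c4 erefl erefl)].
Qed.

Lemma rerouted_no_free_cycle (R : realType) m : (2 < m)%N ->
  ~ exists C : seq 'I_m.*2.+1, free_ham_cycle (rerouted_drawing R m) C.
Proof.
move=> hm [C fC]; have [[_ [uC sC]] _] := fC.
have uv : uniq (map val C) by rewrite map_inj_uniq //; exact: val_inj.
have allC i : (i < m.*2.+1)%N -> i \in map val C.
  move=> hi; apply/mapP; exists (Ordinal hi) => //.
  have sub : {subset C <= enum 'I_m.*2.+1} by move=> x _; rewrite mem_enum.
  have sz : (size (enum 'I_m.*2.+1) <= size C)%N by rewrite size_enum_ord sC.
  by have [_ ->] := uniq_min_size uC sub sz; rewrite mem_enum.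
have [m3|m3] := eqVneq m 3.
  subst m; have ps : perm_eq (map val C) (iota 0 7).
    apply: uniq_perm => // i.
    rewrite mem_iota /=; apply/idP/idP => [/mapP[k _ ->]|/allC //]; exact: ltn_ord.
  have /negP := no_cycle7 ps; apply.
  apply: free_cycle_rel fC; first by move=> i j; rewrite andbC.
  by move=> e /adjacent7_free.
(* For [m > 3] only [0 -- 1] can be free at [0]; [r] keeps just this constraint, making [0] a
   pendant vertex. *)
pose r := fun i j : nat => ((i == 0) ==> (j == 1)) && ((j == 0) ==> (i == 1))%N.
have rs : symmetric r by move=> i j; rewrite /r andbC.
have /negP : ~~ cycle r (map val C).
  apply: (@no_cycle_pendant r _ 0 1) => //; last exact: allC.
    by move=> z; rewrite /r eqxx => /andP[/eqP].
  by rewrite size_map sC; lia.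
apply; apply: free_cycle_rel fC => // e he; rewrite /r.
have ij : (val (val e).1 < val (val e).2)%N by case: (e) => -[].
have -> : (val (val e).2 == 0)%N = false by lia.
rewrite andbT; apply/implyP => /eqP e1; apply/negPn/negP => e2.
by apply: he; apply: edge_zero_crossed => //; lia.
Qed.

Theorem theorem1p1 (R : realType) (n : nat) :
  odd n -> (7 <= n)%N ->
  exists (D : drawing R n) (T : seq 'I_n),
    [/\ is_diagram D, crossing_number_is D (Zn n),
        ham_path T, based D T &
        ~ exists C : seq 'I_n, free_ham_cycle D C].
Proof.
move=> on n7; have [m nm] : exists m, n = m.*2.+1.
  by exists n./2; rewrite -[LHS]odd_double_half on.
subst n; have hm : (2 < m)%N by lia.
exists (rerouted_drawing R m), (enum 'I_m.*2.+1); split.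
- exact: rerouted_is_diagram.
- exact: rerouted_crossing_number.
- by split; [exact: enum_uniq|exact: size_enum_ord].
- exact: rerouted_based.
- exact: rerouted_no_free_cycle.
Qed.
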